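(* Let $P,Q$ be probability measures on a measurable space $(\Omega,\Sigma)$, both absolutely continuous with respect to a measure $\lambda$, with densities $p=dP/d\lambda$, $q=dQ/d\lambda$. Let $(\alpha,\beta)$ be the false positive rate and false negative rate of a nonrandomized test, with characterizing set $E\in\Sigma$, on the Neyman-Pearson boundary of $(P,Q)$. Let $D_f$ be an $f$-divergence. Then the following inequality holds: $$(1-\alpha)\, f\!\left(\frac{\beta}{1-\alpha}\right)+\alpha\, f\!\left(\frac{1-\beta}{\alpha}\right)\le D_f(P\|Q).\qquad ( * )$$ The equality condition for $( * )$ (i.e. equality holds if and only if this is satisfied) is that $f(t)$ is a piecewise linear function with one singular point $t_0$, and $(\alpha,\beta)$ corresponds to the test set $E\cap\{q>0\}=\{x: p(x)/q(x)>t_0\}$. The set of $(\alpha,\beta)$ satisfying $( * )$ is a convex set which includes the Neyman-Pearson region of $(P,Q)$.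
   Context: $f$-divergence: let $f:\mathbb{R}^+\to\overline{\mathbb{R}}$ be a convex function with $f(1)=0$ (with $f(0)$ read as $\lim_{t\to0^+}f(t)$), and let $f'(\infty)=\lim_{t\to 0^+} t f(1/t)$. The $f$-divergence from $P$ to $Q$ is $D_f(P\|Q)=\int_{q>0} f\!\left(\frac{p(x)}{q(x)}\right) q(x)\,d\lambda+f'(\infty)\,P[q=0]$. Convention: for the cases $\alpha=0$ and $\alpha=1$, $0\cdot f(\cdot)=0$ in $( * )$. Tests: the hypotheses are $H_0$: $x$ is a sample from $Q$, and $H_1$: $x$ is a sample from $P$. A (possibly randomized) test is a measurable $\phi:\Omega\to[0,1]$; on observing $x$ it accepts $H_0$ with probability $\phi(x)$ and $H_1$ with probability $1-\phi(x)$. Its false positive rate is $\alpha=\int(1-\phi)\,dQ$ and its false negative rate is $\beta=\int\phi\,dP$. A nonrandomized test is characterized by a set $E\in\Sigma$ ($H_1$ is accepted if $x\in E$, otherwise $H_0$ is accepted), so $\alpha=Q(E)$, $\beta=P(E^c)$. The Neyman-Pearson region is the set of all $(\alpha,\beta)\in[0,1]\times[0,1]$ attained by (possibly randomized) tests. The Neyman-Pearson boundary is the lower boundary of this region, given by the minimum $\beta$ for each $\alpha$.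
   Formalization: In ( * ), 0·f(v/0) is read as v·f'(∞), not 0 (else ( * ) and convexity fail). ''Only if'' (false for P=Q) is proved for finite D_f as: f linear on each side of t_0 (in [0,∞]) over the a.e. range of p/q, and E∩{q>0}={p/q>t_0} up to null sets and points with p/q=t_0. *)

(* Defs.v *)
(* MathComp-Analysis. *)
From HB Require Import structures.
From mathcomp Require Import all_boot all_order all_algebra.
From mathcomp Require Import all_classical all_reals all_analysis.

Set Implicit Arguments.
Unset Strict Implicit.
Unset Printing Implicit Defensive.

Import Order.TTheory GRing.Theory Num.Theory.
Import numFieldNormedType.Exports.

Local Open Scope classical_set_scope.
Local Open Scope ring_scope.

Definition is_density (R : realType) (d : measure_display)
    (T : measurableType d) (lambda : {measure set T -> \bar R})
    (P : probability T R) (p : T -> R) : Prop :=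
  [/\ measurable_fun setT p,
      forall x, 0 <= p x &
      forall A, measurable A -> P A = (\int[lambda]_(x in A) (p x)%:E)%E].

(* f is only relevant on ]0, +oo[. As -oo + +oo = -oo in \bar R, a value -oo
   on one side of 1 would force f 1 = -oo: such an f never takes the value
   -oo on ]0, +oo[, that is, it is a proper convex function. *)
Definition divergence_generator (R : realType) (f : R -> \bar R) : Prop :=
  (forall x y s : R, 0 < x -> 0 < y -> 0 <= s <= 1 ->
     (f ((1 - s) * x + s * y)%R <= (1 - s)%:E * f x + s%:E * f y)%E)
  /\ f 1 = 0%E.

Definition at0 (R : realType) (f : R -> \bar R) (t : R) : \bar R :=
  if t == 0 then lim (f s @[s --> 0^'+]) else f t.

Definition slope_at_infinity (R : realType) (f : R -> \bar R) : \bar R :=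
  lim ((t%:E * f (t^-1)%R)%E @[t --> 0^'+]).

Definition f_div (R : realType) (d : measure_display) (T : measurableType d)
    (lambda : {measure set T -> \bar R}) (P : probability T R)
    (p q : T -> R) (f : R -> \bar R) : \bar R :=
  (\int[lambda]_(x in [set x | (0 < q x)%R])
      (at0 f (p x / q x)%R * (q x)%:E)
   + slope_at_infinity f * P [set x | q x = 0%R])%E.

(* u f(v / u), where 0 f(0 / 0) = 0 and 0 f(v / 0) = v f'(oo) if v > 0. The
   latter matches the singular term of f_div. With 0 f(v / 0) = 0 for v > 0 the
   inequality would fail: take Q = dirac 0, P = (dirac 0 + dirac 1) / 2,
   E = {1} and f(t) = 1 - t, for which D_f(P || Q) = 0 but f(1/2) = 1/2. Both
   conventions agree on (alpha, beta) = (0, 1) and (1, 0), which are the only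
   boundary points with alpha = 0 or 1 when P << Q. *)
Definition weighted (R : realType) (f : R -> \bar R) (u v : R) : \bar R :=
  if u == 0 then (v%:E * slope_at_infinity f)%E else (u%:E * at0 f (v / u)%R)%E.

Definition test_div (R : realType) (f : R -> \bar R) (ab : R * R) : \bar R :=
  (weighted f (1 - ab.1)%R ab.2 + weighted f ab.1 (1 - ab.2)%R)%E.

Definition is_test (R : realType) (d : measure_display)
    (T : measurableType d) (phi : T -> R) : Prop :=
  measurable_fun setT phi /\ forall x, 0 <= phi x <= 1.

(* phi x is the probability of accepting the hypothesis that x comes from Q *)
Definition np_region (R : realType) (d : measure_display)
    (T : measurableType d) (P Q : probability T R) : set (R * R) :=
  [set ab | exists phi : T -> R, is_test phi /\
     ab = (\int[Q]_x (1 - phi x), \int[P]_x phi x)].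

Definition np_boundary (R : realType) (d : measure_display)
    (T : measurableType d) (P Q : probability T R) : set (R * R) :=
  [set ab | np_region P Q ab /\
     forall b, np_region P Q (ab.1, b) -> ab.2 <= b].

Definition piecewise_linear (R : realType) (f : R -> \bar R) (t0 : R) : Prop :=
  exists a0 a1 c : R, a0 != a1 /\
    forall t, 0 < t ->
      f t = (c + (if t <= t0 then a0 else a1) * (t - t0))%:E.

Definition likelihood_ratio (R : realType) (T : Type) (p q : T -> R) (x : T) :
    \bar R :=
  if q x == 0 then +oo%E else (p x / q x)%:E.

Definition affine_on (R : realType) (f : R -> \bar R) (I : interval (\bar R)) :
    Prop :=
  exists a b : R, forall t : R,
    0 <= t -> t%:E \in I -> at0 f t = (a * t + b)%:E.

(* E is, up to null sets and to the values of E on {p / q = t0}, the set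
   {p / q > t0} on {q > 0}, and f is linear on each side of t0 over the range
   of the likelihood ratio. Only that range matters: D_f does not depend on f
   elsewhere (if P = Q both sides of the inequality vanish for all f and E), so
   the linear pieces are required on intervals I0 <= t0 <= I1 that contain a.e.
   the likelihood ratio outside of E and on E, respectively. The bound t0 may
   be +oo (E is null for Q), and I1 contains +oo if P {q = 0} > 0. *)
Definition equality_condition (R : realType) (d : measure_display)
    (T : measurableType d) (lambda : {measure set T -> \bar R})
    (p q : T -> R) (f : R -> \bar R) (E : set T) : Prop :=
  exists (t0 : \bar R) (I0 I1 : interval (\bar R)),
    [/\ {ae lambda, forall x, 0 < q x ->
           ((t0 < (p x / q x)%R%:E)%E -> E x) /\
           (E x -> (t0 <= (p x / q x)%R%:E)%E)},
        {subset I0 <= `[0%E, t0]} /\ {subset I1 <= `[t0, +oo%E]},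
        {ae lambda, forall x, 0 < p x + q x ->
           (~ E x -> likelihood_ratio p q x \in I0) /\
           (E x -> likelihood_ratio p q x \in I1)} &
        affine_on f I0 /\ affine_on f I1].

(* Main.v *)
Require Import Defs.
From HB Require Import structures.
From mathcomp Require Import all_boot all_order all_algebra.
From mathcomp Require Import all_classical all_reals all_analysis.
From mathcomp Require Import measurable_realfun ring lra.

Set Implicit Arguments.
Unset Strict Implicit.
Unset Printing Implicit Defensive.

Import Order.TTheory GRing.Theory Num.Theory.
Import numFieldNormedType.Exports.

Local Open Scope classical_set_scope.
Local Open Scope ring_scope.

(** Write F(u, v) for [weighted f u v], the perspective u f(v / u) of the
    convex function f, completed on u = 0 by the recession slope f'(oo).  On the
    quadrant u, v >= 0 the function F never takes the value -oo, is positively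
    homogeneous ([weightedZ]) and subadditive ([weighted_subadditive]), and
    D_f(P || Q) is the integral of F(q, p) ([f_divE]); the singular term of D_f
    is the part of this integral where q = 0.

    A test phi cuts (q, p) into (phi q, phi p) and ((1 - phi) q, (1 - phi) p).
    By homogeneity F(q, p) is the sum of the values of F on the two pieces, and
    Jensen's inequality for F ([weighted_jensen]) applied to each piece bounds F
    at the pairs of total masses (1 - alpha, beta) and (alpha, 1 - beta).  Their
    sum is the left-hand side of the inequality, which thus holds on the whole
    Neyman-Pearson region ([np_region_sub]).  Sublinearity of F also makes the
    set of solutions (alpha, beta) convex ([test_div_sublevel_convex]).

    When D_f is finite, equality means equality in both applications of Jensen's
    inequality.  Let (U, V) be the integral of (u, v).  Either some linear form
    lies below F and touches it at (U, V), or (U, V) is on the edge of the domain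
    where F is finite, that is, some nonzero linear form vanishes at (U, V) and
    is nonnegative on that domain ([weighted_support]).  In the first case
    equality says that F is equal to the linear form at almost every (u, v): the
    ratios v / u lie in an interval on which f is affine.  In the second case the
    nonnegative form has integral 0, so (u, v) is almost everywhere a multiple of
    (U, V), and the ratio v / u is constant.  Conversely, if almost all ratios
    lie in an interval on which f is affine, so does their mean V / U, which
    gives equality ([weighted_jensen_affine_eq]).  The second case is what makes
    the argument work for an f with infinite values, which may have neither a
    subgradient nor continuity at the ends of its domain.

    It remains to see that the intervals obtained for E and for its complement
    are separated by a threshold t0, which is the Neyman-Pearson lemma.  If
    p < c q on a part A of E and p > c q on a part B of its complement, both of
    positive Q-mass, then moving mass from A to B at constant alpha lowers beta,
    which is impossible on the boundary ([np_swap]).  So for each c one of the two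
    parts is null ([np_level]), and t0 is the supremum of the rational numbers c
    for which the first one is ([np_threshold]). *)

(** * Convex generators *)

Lemma mulr_eq_EFin {R : realType} (c r : R) (z : \bar R) : 0 < c ->
  (c%:E * z = (c * r)%:E)%E -> z = r%:E.
Proof.
move=> c0; case: z => [s| |]; last 2 first.
- by rewrite gt0_muley ?lte_fin.
- by rewrite gt0_muleNy ?lte_fin.
by rewrite -EFinM => -[] /(mulfI (lt0r_neq0 c0)) ->.
Qed.

Section generator.
Context {R : realType}.
Implicit Types (f : R -> \bar R) (t x y m : R).

Lemma near_eq_lim (g h : R -> \bar R) (F : set_system R) {FF : Filter F} :
  (\forall s \near F, g s = h s) -> lim (g s @[s --> F]) = lim (h s @[s --> F]).
Proof.
move=> gh; congr lim; apply/seteqP.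
have hg : \forall s \near F, h s = g s by apply: filterS gh.
by split; exact: near_eq_cvg.
Qed.

Lemma mulr_gtNye (c : R) (z : \bar R) : 0 <= c -> (-oo < z -> -oo < c%:E * z)%E.
Proof.
rewrite le_eqVlt => /predU1P[<-|c0]; first by rewrite mul0e ltNy0.
by case: z => [r| |]; rewrite ?gt0_muley ?lte_fin// -EFinM !ltNyr.
Qed.

(** The point 1 lies strictly between t and t^-1 when t differs from 1, so a
    value -oo at t would propagate to f 1 = 0: in \bar R, -oo absorbs +oo. *)
Lemma generator_ninfty f t : divergence_generator f -> 0 < t -> (-oo < f t)%E.
Proof.
move=> [fconv f1] t0; rewrite ltNye; apply/eqP => ft.
have t1 : 0 < 1 + t by rewrite addr_gt0.
have t01 : 0 <= t / (1 + t) <= 1.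
  by rewrite divr_ge0 ?(ltW t0) ?(ltW t1)//= ler_pdivrMr// mul1r lerDr.
have tV0 : 0 < t^-1 by rewrite invr_gt0.
have := fconv t t^-1 (t / (1 + t)) t0 tV0 t01.
rewrite (_ : (1 - t / (1 + t)) * t + t / (1 + t) * t^-1 = 1); last first.
  by field; rewrite !gt_eqF.
rewrite f1 ft (_ : 1 - t / (1 + t) = (1 + t)^-1); last by field; rewrite gt_eqF.
by rewrite gt0_muleNy ?lte_fin ?invr_gt0// leeNy_eq.
Qed.

(** Convexity with denominators cleared, the form in which slopes are compared. *)
Lemma generator_three_points f x m y : divergence_generator f ->
  0 < x -> x < m -> m < y ->
  ((y - x)%:E * f m <= (y - m)%:E * f x + (m - x)%:E * f y)%E.
Proof.
move=> gf x0 xm my; have [fconv f1] := gf.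
have xy := lt_trans xm my; have yx0 : 0 < y - x by rewrite subr_gt0.
have y0 := lt_trans x0 xy.
have s01 : 0 <= (m - x) / (y - x) <= 1.
  rewrite divr_ge0 ?subr_ge0 ?(ltW xm) ?(ltW xy)//=.
  by rewrite ler_pdivrMr// mul1r lerD2r ltW.
have := fconv x y _ x0 y0 s01.
rewrite (_ : _ * x + _ * y = m); last by field; rewrite gt_eqF.
rewrite -(@lee_pmul2l _ (y - x)%:E) ?fin_numE ?lte_fin//.
rewrite muleDr ?fin_numE//; last first.
  apply: ltninfty_adde_def; rewrite inE; apply: mulr_gtNye.
  - by case/andP: s01 => _; rewrite subr_ge0.
  - exact: generator_ninfty.
  - by case/andP: s01.
  - exact: generator_ninfty.
rewrite !muleA -!EFinM.
rewrite (_ : (y - x) * (1 - _) = y - m); last by field; rewrite gt_eqF.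
by rewrite (_ : (y - x) * _ = m - x)//; field; rewrite gt_eqF.
Qed.

(** The generator of the divergence with P and Q exchanged.  It turns the
    behaviour of f at infinity into behaviour at 0. *)
Definition dual_generator f t : \bar R := (t%:E * f (t^-1)%R)%E.

(** The value at z = (1 - s) x + s y is z f(z^-1), and z^-1 is the mean of x^-1
    and y^-1 with weights (1 - s) x / z and s y / z. *)
Lemma divergence_generator_dual f :
  divergence_generator f -> divergence_generator (dual_generator f).
Proof.
move=> gf; have [fconv f1] := gf; split; last first.
  by rewrite /dual_generator invr1 f1 mule0.
move=> x y s x0 y0 /andP[s0 s1]; rewrite /dual_generator.
set z := (1 - s) * x + s * y.
have z0 : 0 < z.
  move: s0; rewrite le_eqVlt => /predU1P[s0|s0].
    by rewrite /z -s0 subr0 mul1r mul0r addr0.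
  by rewrite ltr_wpDl ?mulr_gt0// mulr_ge0 ?subr_ge0// ltW.
have t0 : 0 <= s * y / z by rewrite divr_ge0 ?mulr_ge0 ?(ltW y0) ?(ltW z0).
have tE : 1 - s * y / z = (1 - s) * x / z.
  by rewrite /z; field; rewrite -/z gt_eqF.
have t1 : 0 <= 1 - s * y / z.
  by rewrite tE divr_ge0 ?mulr_ge0 ?subr_ge0 ?(ltW x0) ?(ltW z0).
have t01 : 0 <= s * y / z <= 1 by rewrite t0/= -subr_ge0.
have xV0 : 0 < x^-1 by rewrite invr_gt0.
have yV0 : 0 < y^-1 by rewrite invr_gt0.
have := fconv _ _ _ xV0 yV0 t01.
rewrite (_ : _ * x^-1 + _ * y^-1 = z^-1); last first.
  by rewrite tE /z; field; rewrite -/z !gt_eqF.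
rewrite -(@lee_pmul2l _ z%:E) ?fin_numE ?lte_fin//.
rewrite muleDr ?fin_numE//; last first.
  by apply: ltninfty_adde_def; rewrite inE; apply: mulr_gtNye => //;
    exact: generator_ninfty.
rewrite !muleA -!EFinM tE.
rewrite (_ : z * ((1 - s) * x / z) = (1 - s) * x); last by field; rewrite gt_eqF.
by rewrite (_ : z * (s * y / z) = s * y)//; field; rewrite gt_eqF.
Qed.

Lemma slope_at_infinityE f : slope_at_infinity f = at0 (dual_generator f) 0.
Proof. by rewrite /at0 eqxx. Qed.

(** As f 1 = 0, the quotient f s / (1 - s) is minus the slope of the chord from s
    to 1, so it is nonincreasing in s and has a limit at 0; the factor 1 - s
    tends to 1. *)
Lemma generator_cvg_at0 f : divergence_generator f ->
  cvg (f s @[s --> 0^'+]).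
Proof.
move=> gf; have [_ f1] := gf.
pose h s := ((1 - s)^-1%:E * f s)%E.
have hcvg : h s @[s --> 0^'+] -->
    ereal_sup (h @` [set` Interval (BRight 0) (BLeft 1)]).
  apply: nonincreasing_at_right_cvge => [|x y].
    by rewrite bnd_simp.
  rewrite !in_itv/= => /andP[x0 x1] /andP[y0 y1].
  rewrite le_eqVlt => /predU1P[->//|xy].
  have := generator_three_points gf x0 xy y1.
  rewrite f1 mule0 adde0 /h => H.
  have x1' : 0 < 1 - x by rewrite subr_gt0.
  have y1' : 0 < 1 - y by rewrite subr_gt0.
  have : 0 < ((1 - x) * (1 - y))^-1 by rewrite invr_gt0 mulr_gt0.
  rewrite -lte_fin => c0.
  move: H; rewrite -(lee_pmul2l _ c0) ?fin_numE// !muleA -!EFinM.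
  rewrite (_ : _^-1 * (1 - x) = (1 - y)^-1); last by field; rewrite !gt_eqF.
  by rewrite (_ : _^-1 * (1 - y) = (1 - x)^-1)//; field; rewrite !gt_eqF.
have c1 : ((1 - s)%:E)%E @[s --> 0^'+] --> (1 : R)%:E.
  apply: cvg_EFin; first exact: nearW.
  rewrite -[X in _ --> X]subr0.
  by apply: cvgB; [exact: cvg_cst|apply: cvg_at_right_filter; exact: cvg_id].
have {}hcvg : ((1 - s)%:E * h s)%E @[s --> 0^'+] -->
    (1%:E * ereal_sup (h @` [set` Interval (BRight 0%R) (BLeft 1%R)]))%E.
  by apply: cvgeM => //; rewrite mule_defE onee_eq0 andbF.
apply/cvg_ex; exists (1%:E * ereal_sup (h @` [set` Interval (BRight 0%R) (BLeft 1%R)]))%E.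
apply: cvg_trans hcvg; apply: near_eq_cvg.
near=> s; have s1 : s < 1 by near: s; exact: nbhs_right_lt.
by rewrite /h muleA -EFinM divff ?mul1e// gt_eqF// subr_gt0.
Unshelve. all: by end_near.
Qed.

Lemma cvg_at0_affine (a b : R) : ((a * s + b)%:E) @[s --> 0^'+] --> b%:E.
Proof.
apply: cvg_EFin; first exact: nearW.
rewrite -[X in _ --> X]add0r; apply: cvgD; last exact: cvg_cst.
rewrite -[X in _ --> X](mulr0 a); apply: cvgM; first exact: cvg_cst.
by apply: cvg_at_right_filter; exact: cvg_id.
Qed.

Lemma at0_ge_affine f (a b : R) : divergence_generator f ->
  (forall t, 0 < t -> ((a * t + b)%:E <= f t)%E) -> (b%:E <= at0 f 0)%E.
Proof.
move=> gf fab; rewrite /at0 eqxx -(cvg_lim _ (@cvg_at0_affine a b))//.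
apply: lee_lim; [|exact: generator_cvg_at0|].
  by apply/(@cvg_ex (\bar R)); exists b%:E; exact: cvg_at0_affine.
by near=> s; apply: fab; near: s; exact: nbhs_right_gt.
Unshelve. all: by end_near. Qed.

Lemma at0_eq_affine f (a b e : R) : 0 < e ->
  (forall t, 0 < t < e -> f t = (a * t + b)%:E) -> at0 f 0 = b%:E.
Proof.
move=> e0 fab; rewrite /at0 eqxx -(cvg_lim _ (@cvg_at0_affine a b))//.
apply: near_eq_lim; near=> s; apply: fab; apply/andP; split.
  by near: s; exact: nbhs_right_gt.
by near: s; exact: nbhs_right_lt.
Unshelve. all: by end_near. Qed.

Lemma at0_pinfty f m : 0 < m -> (forall t, 0 < t < m -> f t = +oo%E) ->
  at0 f 0 = +oo%E.
Proof.
move=> m0 foo; rewrite /at0 eqxx -[RHS](@lim_cst _ (@ereal_hausdorff R) R (0^'+) _ +oo%E).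
apply: near_eq_lim; near=> s; apply: foo; apply/andP; split.
  by near: s; exact: nbhs_right_gt.
by near: s; exact: nbhs_right_lt.
Unshelve. all: by end_near. Qed.

Lemma dual_generator_ge_affine f (a b : R) :
  (forall t, 0 < t -> ((a * t + b)%:E <= f t)%E) ->
  forall t, 0 < t -> ((b * t + a)%:E <= dual_generator f t)%E.
Proof.
move=> fab t t0; rewrite /dual_generator.
have := fab t^-1; rewrite invr_gt0 => /(_ t0).
rewrite -(@lee_pmul2l _ t%:E) ?fin_numE ?lte_fin// -EFinM.
by congr (_ <= _)%E; congr EFin; field; rewrite gt_eqF.
Qed.

(** On ]0, (r0 + 1)^-1[ the dual generator is the affine function b t + a. *)
Lemma slope_at_infinity_affine f (a b r0 : R) :
  0 <= r0 -> (forall t, r0 <= t -> at0 f t = (a * t + b)%:E) ->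
  slope_at_infinity f = a%:E.
Proof.
move=> r0_ge0 fab; rewrite slope_at_infinityE.
have e0 : 0 < (r0 + 1)^-1 by rewrite invr_gt0 ltr_wpDl.
apply: (at0_eq_affine (a := b) e0) => t /andP[t0 te].
have tV0 : 0 < t^-1 by rewrite invr_gt0.
have r0t : r0 <= t^-1.
  move: te; rewrite -div1r ltr_pdivlMr ?ltr_wpDl// -div1r ler_pdivlMr//.
  by nra.
have := fab _ r0t; rewrite /at0 gt_eqF// /dual_generator => ->.
by rewrite -EFinM; congr EFin; field; rewrite gt_eqF.
Qed.

Lemma weightedZ f (s u v : R) :
  weighted f (s * u) (s * v) = (s%:E * weighted f u v)%E.
Proof.
rewrite /weighted; have [->|s0] := eqVneq s 0; first by rewrite !mul0r eqxx !mul0e.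
rewrite mulf_eq0 (negbTE s0)/=; have [_|u0] := eqVneq u 0.
  by rewrite EFinM muleA.
by rewrite EFinM -muleA (_ : s * v / (s * u) = v / u)//; field; rewrite u0.
Qed.

Lemma weighted_ge_affine f (a b u v : R) : divergence_generator f ->
  (forall t, 0 < t -> ((a * t + b)%:E <= f t)%E) -> 0 <= u -> 0 <= v ->
  ((b * u + a * v)%:E <= weighted f u v)%E.
Proof.
move=> gf fab u0 v0; rewrite /weighted; case: eqVneq => [->|u0'].
  rewrite mulr0 add0r slope_at_infinityE mulrC EFinM lee_wpmul2l ?lee_fin//.
  apply: (@at0_ge_affine _ b); first exact: divergence_generator_dual.
  exact: dual_generator_ge_affine.
have {}u0 : 0 < u by rewrite lt_def u0'.
have -> : b * u + a * v = u * (a * (v / u) + b) by field.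
rewrite EFinM lee_wpmul2l ?lee_fin ?(ltW u0)//.
have [->|v0'] := eqVneq v 0.
  by rewrite mul0r mulr0 add0r; exact: at0_ge_affine fab.
have vu0 : 0 < v / u by rewrite divr_gt0// lt_def v0'.
by rewrite /at0 gt_eqF//; exact: fab.
Qed.

(** If f is finite somewhere on both sides of m, the slopes of the chords ending
    at m are bounded above by those of the chords starting at m, and the supremum
    of the former is the slope of a support line.  Otherwise f is infinite on one
    side of m, and a support line need not exist. *)
Lemma generator_support f m : divergence_generator f -> 0 < m ->
  [\/ exists a b : R, f m = (a * m + b)%:E /\
        (forall t, 0 < t -> ((a * t + b)%:E <= f t)%E),
      forall t, m < t -> f t = +oo%E |
      forall t, 0 < t < m -> f t = +oo%E].
Proof.
move=> gf m0.
have [foo|/existsNP[y /not_implyP[my fy]]] := pselect (forall t, m < t -> f t = +oo%E).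
  by constructor 2.
have [foo|/existsNP[x /not_implyP[/andP[x0 xm] fx]]] :=
  pselect (forall t, 0 < t < m -> f t = +oo%E).
  by constructor 3.
constructor 1.
have fP t : 0 < t -> f t != +oo%E -> exists r, f t = r%:E.
  move=> t0; have := generator_ninfty gf t0.
  by case: (f t) => [r| |]// _ _; exists r.
have [fxr fxE] := fP _ x0 (introN eqP fx).
have [fyr fyE] := fP _ (lt_trans m0 my) (introN eqP fy).
have [fmr fmE] : exists r, f m = r%:E.
  apply: fP => //; apply/eqP => fm.
  have := generator_three_points gf x0 xm my.
  rewrite fm fxE fyE gt0_muley ?lte_fin ?subr_gt0 ?(lt_trans xm my)//.
pose S := [set r | exists t ft,
  [/\ 0 < t, t < m, f t = ft%:E & r = (fmr - ft) / (m - t)]].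
have Sub z fz : m < z -> f z = fz%:E -> ubound S ((fz - fmr) / (z - m)).
  move=> mz fzE _ [t [ft [t0 tm ftE ->]]].
  have := generator_three_points gf t0 tm mz.
  rewrite fmE ftE fzE -!EFinM -EFinD lee_fin => H.
  rewrite ler_pdivrMr ?subr_gt0// mulrAC ler_pdivlMr ?subr_gt0//.
  lra.
have Sx : S ((fmr - fxr) / (m - x)) by exists x, fxr.
have hS : has_sup S.
  by split; [exists ((fmr - fxr) / (m - x))|exists ((fyr - fmr) / (y - m)); exact: Sub].
exists (sup S), (fmr - sup S * m); split; first by rewrite fmE; congr EFin; ring.
move=> t t0; have [ft|ft] := eqVneq (f t) +oo%E; first by rewrite ft leey.
have [ftr ftE] := fP _ t0 ft; rewrite ftE lee_fin.
have [tm|mt|tm] := ltgtP t m.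
- have : (fmr - ftr) / (m - t) <= sup S.
    by apply: sup_upper_bound => //; exists t, ftr.
  by rewrite ler_pdivrMr ?subr_gt0//; lra.
- have : sup S <= (ftr - fmr) / (t - m) by apply: ge_sup; [exact: hS.1|exact: Sub].
  by rewrite ler_pdivlMr ?subr_gt0//; lra.
- by move: ftE; rewrite tm fmE => -[->]; lra.
Qed.

End generator.

(** * The perspective of a generator *)

Section perspective.
Context {R : realType}.
Implicit Types (f : R -> \bar R) (u v a b c d s t : R).

(** A support line at 1 may not exist, as 1 may be an endpoint of the domain of
    f.  If f is finite at another point t, the midpoint of 1 and t is interior
    to that domain. *)
Lemma generator_affine_minorant f : divergence_generator f ->
  exists a b : R, forall t, 0 < t -> ((a * t + b)%:E <= f t)%E.
Proof.
move=> gf.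
have [foo|] := pselect (forall t, 0 < t -> t != 1 -> f t = +oo%E).
  exists 0, 0 => t t0; rewrite mul0r addr0.
  have [->|t1] := eqVneq t 1; first by rewrite gf.2.
  by rewrite foo// leey.
move=> /existsNP[t /not_implyP[t0 /not_implyP[t1 ft]]].
have m0 : 0 < (t + 1) / 2 by lra.
have [t1'|t1'|] := ltgtP t 1; last by move/eqP; rewrite (negbTE t1).
- have [[a [b [_ fab]]]|foo|foo] := generator_support gf m0; first by exists a, b.
    by have : f 1 = +oo%E; [apply: foo; lra|rewrite gf.2].
  by exfalso; apply: ft; apply: foo; lra.
- have [[a [b [_ fab]]]|foo|foo] := generator_support gf m0; first by exists a, b.
    by exfalso; apply: ft; apply: foo; lra.
  by have : f 1 = +oo%E; [apply: foo; lra|rewrite gf.2].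
Qed.

Lemma weighted_ninfty f u v : divergence_generator f -> 0 <= u -> 0 <= v ->
  (-oo < weighted f u v)%E.
Proof.
move=> gf u0 v0; have [a [b fab]] := generator_affine_minorant gf.
exact: lt_le_trans (ltNyr _) (weighted_ge_affine gf fab u0 v0).
Qed.

Lemma at0E f t : at0 f t = weighted f 1 t.
Proof. by rewrite /weighted oner_eq0 divr1 mul1e. Qed.

Lemma slope_at_infinity_weighted f : slope_at_infinity f = weighted f 0 1.
Proof. by rewrite /weighted eqxx mul1e. Qed.

(** The support alternative in homogeneous form.  The second case collects the
    points on the axes and those whose ratio v0 / u0 has f infinite on one side. *)
Lemma weighted_support f u0 v0 : divergence_generator f ->
  0 <= u0 -> 0 <= v0 ->
  (exists a b, weighted f u0 v0 = (b * u0 + a * v0)%:E /\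
     forall u v, 0 <= u -> 0 <= v -> ((b * u + a * v)%:E <= weighted f u v)%E) \/
  (exists c d, [/\ (c != 0) || (d != 0), c * u0 + d * v0 = 0 &
     forall u v, 0 <= u -> 0 <= v -> (weighted f u v < +oo)%E ->
       0 <= c * u + d * v]).
Proof.
move=> gf; rewrite le_eqVlt => /predU1P[<- _|u0_gt0].
  right; exists 1, 0; rewrite oner_eq0 mulr0 mul0r addr0; split => // u v u_ge0 _ _.
  by rewrite mul1r mul0r addr0.
rewrite le_eqVlt => /predU1P[<-|v0_gt0].
  right; exists 0, 1; rewrite oner_eq0 orbT mulr0 mul0r addr0; split => // u v _ v_ge0 _.
  by rewrite mul1r mul0r add0r.
set m := v0 / u0; have m0 : 0 < m by rewrite divr_gt0.
have v0E : v0 = m * u0 by rewrite /m divfK ?gt_eqF.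
have [[a [b [fm fab]]]|foo|foo] := generator_support gf m0.
- left; exists a, b; split; last by move=> u v; exact: weighted_ge_affine.
  rewrite /weighted gt_eqF// -/m /at0 gt_eqF// fm -EFinM v0E; congr EFin; ring.
- right; exists m, (- 1); split; first by rewrite gt_eqF.
    by rewrite v0E; ring.
  move=> u v u_ge0 v_ge0 fuv; rewrite mulN1r subr_ge0 leNgt; apply/negP => uv.
  move: fuv; rewrite /weighted; case: eqVneq => [u_eq0|u_neq0].
    rewrite slope_at_infinityE (@at0_pinfty _ _ m^-1) ?invr_gt0//.
      by rewrite gt0_muley// lte_fin; move: uv; rewrite u_eq0 mulr0.
    move=> t /andP[t0 tm]; rewrite /dual_generator foo ?gt0_muley ?lte_fin//.
    by rewrite -[X in X < _]invrK ltf_pV2// posrE invr_gt0.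
  have u_gt0 : 0 < u by rewrite lt_def u_neq0.
  have mvu : m < v / u by rewrite ltr_pdivlMr.
  by rewrite /at0 gt_eqF ?(lt_trans m0)// foo// gt0_muley.
- right; exists (- m), 1; split; first by rewrite oppr_eq0 gt_eqF.
    by rewrite v0E; ring.
  move=> u v u_ge0 v_ge0 fuv; rewrite mul1r mulNr addrC subr_ge0 leNgt; apply/negP => uv.
  move: fuv; rewrite /weighted; case: eqVneq => [u_eq0|u_neq0].
    by move: uv; rewrite u_eq0 mulr0 ltNge v_ge0.
  have u_gt0 : 0 < u by rewrite lt_def u_neq0.
  have mvu : v / u < m by rewrite ltr_pdivrMr.
  have [v_eq0|v_neq0] := eqVneq v 0.
    by rewrite v_eq0 mul0r (at0_pinfty m0 foo) gt0_muley.
  have vu0 : 0 < v / u by rewrite divr_gt0// lt_def v_neq0.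
  by rewrite /at0 gt_eqF// foo ?vu0// gt0_muley.
Qed.

(** Two vectors in the kernel of a nonzero linear form of the plane are
    proportional; the factor is read off the sums of coordinates. *)
Lemma line_proportional c d u v u0 v0 : (c != 0) || (d != 0) ->
  c * u0 + d * v0 = 0 -> c * u + d * v = 0 -> u0 + v0 != 0 ->
  u = (u + v) / (u0 + v0) * u0 /\ v = (u + v) / (u0 + v0) * v0.
Proof.
move=> cd e0 e uv0.
have uv : u * v0 = v * u0.
  case/orP: cd => [c0|d0].
    apply: (mulfI c0); apply/eqP; rewrite -subr_eq0; apply/eqP.
    transitivity ((c * u + d * v) * v0 - (c * u0 + d * v0) * v); first by ring.
    by rewrite e e0; ring.
  apply: (mulfI d0); apply/eqP; rewrite -subr_eq0; apply/eqP.
  transitivity ((c * u0 + d * v0) * u - (c * u + d * v) * u0); first by ring.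
  by rewrite e e0; ring.
split; apply: (mulIf uv0).
  by rewrite mulrAC divfK// mulrDr mulrDl uv.
by rewrite mulrAC divfK// mulrDr mulrDl -uv.
Qed.

(** This is Jensen's inequality for two points.  On the edge of the domain of F
    both points are multiples of their sum, and F is additive along a ray. *)
Lemma weighted_subadditive f u1 v1 u2 v2 : divergence_generator f ->
  0 <= u1 -> 0 <= v1 -> 0 <= u2 -> 0 <= v2 ->
  (weighted f (u1 + u2)%R (v1 + v2)%R <= weighted f u1 v1 + weighted f u2 v2)%E.
Proof.
move=> gf u1_ge0 v1_ge0 u2_ge0 v2_ge0.
have F1 := weighted_ninfty gf u1_ge0 v1_ge0.
have F2 := weighted_ninfty gf u2_ge0 v2_ge0.
have [F1oo|F1oo] := eqVneq (weighted f u1 v1) +oo%E.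
  by rewrite F1oo addye ?leey// gt_eqF.
have [F2oo|F2oo] := eqVneq (weighted f u2 v2) +oo%E.
  by rewrite F2oo addey ?leey// gt_eqF.
set U := u1 + u2; set V := v1 + v2.
have U_ge0 : 0 <= U by exact: addr_ge0.
have V_ge0 : 0 <= V by exact: addr_ge0.
have [[a [b [-> Fab]]]|[c [d [cd e dom]]]] := weighted_support gf U_ge0 V_ge0.
  rewrite (_ : _ + _ = (b * u1 + a * v1) + (b * u2 + a * v2)); last by rewrite /U /V; ring.
  by rewrite EFinD; apply: leeD; exact: Fab.
have n1 := dom _ _ u1_ge0 v1_ge0; have n2 := dom _ _ u2_ge0 v2_ge0.
rewrite !ltey in n1 n2; move/(_ F1oo) in n1; move/(_ F2oo) in n2.
have e' : (c * u1 + d * v1) + (c * u2 + d * v2) = 0 by rewrite -e /U /V; ring.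
have [UV0|UV0] := eqVneq (U + V) 0.
  have [u10 v10 u20 v20] : [/\ u1 = 0, v1 = 0, u2 = 0 & v2 = 0].
    by move: UV0; rewrite /U /V => UV0; split; lra.
  by rewrite /U /V u10 v10 u20 v20 addr0 /weighted eqxx !mul0e adde0.
have [u1E v1E] : u1 = (u1 + v1) / (U + V) * U /\ v1 = (u1 + v1) / (U + V) * V.
  by apply: (line_proportional cd) => //; lra.
have [u2E v2E] : u2 = (u2 + v2) / (U + V) * U /\ v2 = (u2 + v2) / (U + V) * V.
  by apply: (line_proportional cd) => //; lra.
have -> : weighted f u1 v1 = (((u1 + v1) / (U + V))%:E * weighted f U V)%E.
  by rewrite -weightedZ -u1E -v1E.
have -> : weighted f u2 v2 = (((u2 + v2) / (U + V))%:E * weighted f U V)%E.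
  by rewrite -weightedZ -u2E -v2E.
rewrite -ge0_muleDl ?lee_fin ?divr_ge0 ?addr_ge0//.
rewrite -EFinD -mulrDl (_ : _ / _ = 1) ?mul1e//.
by rewrite (_ : u1 + v1 + (u2 + v2) = U + V) ?divff// /U /V; ring.
Qed.

End perspective.

(** The ends are the infimum and the supremum of J, each closed when attained.
    The second boolean is negated because a right bound is closed when its
    [BSide] flag is false. *)
Lemma order_convex_itv (R : realType) (J : set (\bar R)) :
  (forall x y z, J x -> J y -> (x <= z <= y)%E -> J z) ->
  exists I : interval (\bar R), forall x, x \in I <-> J x.
Proof.
move=> cJ.
exists (Interval (BSide `[< J (ereal_inf J) >] (ereal_inf J))
                 (BSide (~~ `[< J (ereal_sup J) >]) (ereal_sup J))) => x.
rewrite inE/= /Order.le/= /Order.le/= implybF negbK; split => [/andP[infx xsup]|Jx].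
  have [y Jy yx] : exists2 y, J y & (y <= x)%E.
    move: infx; case: asboolP => [Jinf infx|Jinf /ereal_inf_lt[y Jy /ltW]]; last by exists y.
    by exists (ereal_inf J).
  have [z Jz xz] : exists2 z, J z & (x <= z)%E.
    move: xsup; case: asboolP => [Jsup xsup|Jsup /ereal_sup_gt[z Jz /ltW]]; last by exists z.
    by exists (ereal_sup J).
  by apply: (cJ y z) => //; rewrite yx.
apply/andP; split; case: asboolP => [Jb|Jb] /=.
- exact: ereal_inf_lbound.
- rewrite lt_neqAle ereal_inf_lbound// andbT; apply/eqP => infx.
  by apply: Jb; rewrite infx.
- exact: ereal_sup_ubound.
- rewrite lt_neqAle ereal_sup_ubound// andbT; apply/eqP => xsup.
  by apply: Jb; rewrite -xsup.
Qed.

Lemma mem_itv_between (R : realType) (I : interval (\bar R)) (x y z : \bar R) :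
  x \in I -> y \in I -> (x <= z <= y)%E -> z \in I.
Proof.
case: I => l r; rewrite !itv_boundlr => /andP[lx _] /andP[_ yr] /andP[xz zy].
by rewrite (le_trans lx)/= ?(le_trans _ yr)// bnd_simp.
Qed.

Section measurability.
Context {R : realType}.
Implicit Types (f : R -> \bar R).

(** Sublevel sets of a convex function are intervals. *)
Lemma measurable_generator f : divergence_generator f ->
  measurable_fun (`]0%R, +oo[%classic : set R) f.
Proof.
move=> gf; apply: (measurability _ (ErealGenInftyO.measurableE R)).
move=> _ [_ [r ->] <-]; apply: is_interval_measurable => x y /=.
rewrite !in_itv/= !andbT => -[x0 fx] [y0 fy] z /andP[].
rewrite le_eqVlt => /predU1P[<-|xz]; first by rewrite in_itv/= andbT.
rewrite le_eqVlt => /predU1P[->|zy]; first by rewrite in_itv/= andbT.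
have z0 := lt_trans x0 xz; rewrite !in_itv/= andbT; split => //.
have := generator_three_points gf x0 xz zy.
have := generator_ninfty gf x0; have := generator_ninfty gf y0.
move: fx fy; case: (f x) (f y) => [fx| |]// [fy| |]//; rewrite !lte_fin => fx_lt fy_lt _ _.
have := generator_ninfty gf z0; case: (f z) => [fz| |]// _.
  rewrite -!EFinM -EFinD lee_fin lte_fin => H; rewrite -subr_gt0.
  have yx : 0 < y - x by rewrite subr_gt0 (lt_trans xz).
  rewrite -(pmulr_rgt0 _ yx).
  have : 0 < (y - z) * (r - fx) by rewrite mulr_gt0 ?subr_gt0.
  have : 0 < (z - x) * (r - fy) by rewrite mulr_gt0 ?subr_gt0.
  lra.
by rewrite gt0_muley ?lte_fin ?subr_gt0 ?(lt_trans xz)// -!EFinM -EFinD leye_eq.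
Qed.

Lemma measurable_weighted f d (T : measurableType d) (u v : T -> R) :
  divergence_generator f ->
  measurable_fun setT u -> measurable_fun setT v ->
  (forall x, 0 <= u x) -> (forall x, 0 <= v x) ->
  measurable_fun setT (fun x => weighted f (u x) (v x)).
Proof.
move=> gf mu mv u0 v0; rewrite /weighted; apply: measurable_fun_ifT.
- exact: measurable_fun_eqr.
- by apply: emeasurable_funM => //; exact/measurable_EFinP.
apply: emeasurable_funM; first exact/measurable_EFinP.
apply: (@measurable_comp _ _ _ _ _ _ (`[0%R, +oo[%classic : set R)
  (at0 f) setT (fun x => v x / u x)) => //.
- by move=> _ [x _ <-]/=; rewrite in_itv/= andbT divr_ge0.
- apply: measurable_fun_if => //.
  + by apply: measurable_fun_eqr.
  + apply: measurable_funS (measurable_generator gf) => // t/=.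
    rewrite !in_itv/= !andbT => -[t0 /negbT tn0].
    by rewrite lt_def tn0.
(* the inverse is a real power on nonnegative reals *)
- under eq_fun do rewrite -powR_inv1//.
  apply: measurable_funM => //.
  exact: (measurableT_comp (measurable_powR (- 1)) mu).
Qed.

End measurability.

(** * Integration lemmas *)

Section ae.
Context {R : realType} {d : measure_display} {T : measurableType d}.
Variable mu : {measure set T -> \bar R}.

Lemma ae_ge0_integral_eq0 (h : T -> \bar R) : measurable_fun setT h ->
  {ae mu, forall x, (0 <= h x)%E} -> (\int[mu]_x h x = 0)%E ->
  {ae mu, forall x, h x = 0%E}.
Proof.
move=> mh h0 Ih.
have /ae_eq_integral_abs : (\int[mu]_x `|h x| = 0)%E.
  rewrite -Ih; apply: ae_eq_integral => //; first exact: measurableT_comp.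
  by apply: filterS h0 => x hx _; rewrite gee0_abs.
move=> /(_ measurableT mh); apply: filterS => x /=; exact.
Qed.

Lemma integralZl_nNy (D : set T) (k : \bar R) (h : T -> R) : measurable D ->
  (-oo < k)%E -> mu.-integrable D (EFin \o h) -> (forall x, 0 <= h x) ->
  (\int[mu]_(x in D) (k * (h x)%:E) = k * \int[mu]_(x in D) (h x)%:E)%E.
Proof.
move=> mD; case: k => [r| |]// _ ih h0; first by rewrite integralZl.
rewrite ge0_integralZl//; [exact: measurable_int ih|by move=> x _; rewrite lee_fin].
Qed.

Lemma integrable_bounded_below (l : T -> R) (h : T -> \bar R) :
  mu.-integrable setT (EFin \o l) -> measurable_fun setT h ->
  (forall x, ((l x)%:E <= h x)%E) -> (\int[mu]_x h x < +oo)%E ->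
  mu.-integrable setT h.
Proof.
move=> il mh lh hoo.
have hneg : (\int[mu]_x h^\- x < +oo)%E.
  have /integrableP[_] := integrable_funeneg measurableT il.
  apply: le_lt_trans; apply: ge0_le_integral => //.
  - exact: measurable_funeneg.
  - by apply: measurableT_comp => //; apply: measurable_funeneg; exact: measurable_int il.
  - move=> x _; rewrite gee0_abs ?funeneg_ge0// !funenegE.
    by rewrite ge_max le_max leeN2 lh/= le_max lexx orbT.
apply/integrableP; split => //.
rewrite -/(abse \o h) fune_abse ge0_integralD//; last 2 first.
- exact: measurable_funepos.
- exact: measurable_funeneg.
apply: lte_add_pinfty => //.
move: hoo; rewrite integralE.
have : (\int[mu]_x h^\- x)%E \is a fin_num by rewrite ge0_fin_numE// integral_ge0.
case: (\int[mu]_x h^\- x)%E => [r| |]// _.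
by case: (\int[mu]_x h^\+ x)%E => [s| |]// _; rewrite ltry.
Qed.

Lemma integrable_between (l k : T -> R) (h : T -> \bar R) :
  mu.-integrable setT (EFin \o l) -> mu.-integrable setT (EFin \o k) ->
  measurable_fun setT h -> (forall x, (l x)%:E <= h x <= (k x)%:E)%E ->
  mu.-integrable setT h.
Proof.
move=> il ik mh lhk.
have iN := integrableD measurableT (integrable_abse il) (integrable_abse ik).
apply: le_integrable iN => // x _; have := lhk x.
case: (h x) => [r| |]//=; rewrite ?lee_fin ?leye_eq ?leeNy_eq ?andbF//.
move=> /andP[lr rk]; rewrite [leRHS]ger0_norm ?addr_ge0//.
rewrite ler_norml; have := ler_norm (k x); have := ler_norm (- l x).
have := normr_ge0 (k x); have := normr_ge0 (l x); rewrite normrN.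
by move=> *; apply/andP; split; lra.
Qed.

End ae.

(** * Jensen's inequality for the perspective *)

Section jensen.
Context {R : realType} {d : measure_display} {T : measurableType d}.
Variables (mu : {measure set T -> \bar R}) (f : R -> \bar R).
Hypothesis gf : divergence_generator f.
Variables (u v : T -> R) (U V : R).
Hypotheses (u_ge0 : forall x, 0 <= u x) (v_ge0 : forall x, 0 <= v x).
Hypotheses (iu : mu.-integrable setT (EFin \o u)).
Hypotheses (iv : mu.-integrable setT (EFin \o v)).
Hypotheses (IU : (\int[mu]_x (u x)%:E = U%:E)%E).
Hypotheses (IV : (\int[mu]_x (v x)%:E = V%:E)%E).

Let mu_ : measurable_fun setT u.
Proof. by apply/measurable_EFinP; exact: measurable_int iu. Qed.

Let mv_ : measurable_fun setT v.
Proof. by apply/measurable_EFinP; exact: measurable_int iv. Qed.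

Let U_ge0 : 0 <= U.
Proof. by rewrite -lee_fin -IU; apply: integral_ge0 => x _; rewrite lee_fin. Qed.

Let V_ge0 : 0 <= V.
Proof. by rewrite -lee_fin -IV; apply: integral_ge0 => x _; rewrite lee_fin. Qed.

Lemma integrable_lin (b a : R) :
  mu.-integrable setT (fun x => (b * u x + a * v x)%:E).
Proof.
have := integrableD measurableT (integrableZl measurableT b iu)
  (integrableZl measurableT a iv).
exact: eq_integrable.
Qed.

Lemma integral_lin (b a : R) :
  (\int[mu]_x (b * u x + a * v x)%:E = (b * U + a * V)%:E)%E.
Proof.
under eq_integral do rewrite EFinD 2!EFinM.
rewrite integralD//; [|exact: integrableZl|exact: integrableZl].
by rewrite !integralZl// IU IV -!EFinM -EFinD.
Qed.

Lemma ae_lin_eq0 (c e : R) : {ae mu, forall x, 0 <= c * u x + e * v x} ->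
  c * U + e * V = 0 -> {ae mu, forall x, c * u x + e * v x = 0}.
Proof.
move=> n0 nUV.
have : {ae mu, forall x, (c * u x + e * v x)%:E = 0%E}.
  apply: ae_ge0_integral_eq0.
  - exact: measurable_int (integrable_lin c e).
  - exact: n0.
  - by rewrite integral_lin nUV.
by apply: filterS => x [].
Qed.

Let F x := weighted f (u x) (v x).

Definition ae_proportional := {ae mu, forall x, exists s : R,
  [/\ 0 <= s, u x = s * U & v x = s * V]}.

(** F is linear along the ray through (U, V), and the factor
    (u + v) / (U + V) has integral 1. *)
Lemma weighted_integral_proportional : ae_proportional ->
  (\int[mu]_x F x = weighted f U V)%E.
Proof.
move=> prop; have [UV0|UV0] := eqVneq (U + V) 0.
  have [U0 V0] : U = 0 /\ V = 0 by split; move: U_ge0 V_ge0; lra.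
  rewrite U0 V0 /weighted eqxx mul0e -[RHS](integral0 mu setT).
  apply: ae_eq_integral => //; first exact: measurable_weighted.
  apply: filterS prop => x [s [_ us vs]] _.
  by rewrite /F us vs U0 V0 mulr0 /weighted eqxx mul0e.
have -> : (\int[mu]_x F x =
    \int[mu]_x (weighted f U V * ((u x + v x) / (U + V))%:E))%E.
  apply: ae_eq_integral => //; first exact: measurable_weighted.
    apply: emeasurable_funM => //; apply/measurable_EFinP.
    by apply: measurable_funM => //; exact: measurable_funD.
  apply: filterS prop => x [s [_ us vs]] _.
  by rewrite /F us vs -mulrDr mulfK// weightedZ muleC.
have E1 : (\int[mu]_x ((u x + v x) / (U + V))%:E = 1)%E.
  have := integral_lin (U + V)^-1 (U + V)^-1.
  rewrite -mulrDr mulVf// => <-; apply: eq_integral => x _; congr EFin; ring.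
rewrite integralZl_nNy ?E1 ?mule1//.
- exact: weighted_ninfty.
- have := integrable_lin (U + V)^-1 (U + V)^-1.
  by apply: eq_integrable => // x _ /=; congr EFin; ring.
- by move=> x; rewrite divr_ge0 ?addr_ge0.
Qed.

Hypothesis iF : mu.-integrable setT F.

(** On the edge of the domain of F, the form given by [weighted_support] is
    nonnegative at almost every (u, v) because F(u, v) is finite almost
    everywhere; its integral is its value 0 at (U, V). *)
Lemma weighted_support_or_proportional :
  (exists a b, weighted f U V = (b * U + a * V)%:E /\
     forall s t, 0 <= s -> 0 <= t -> ((b * s + a * t)%:E <= weighted f s t)%E) \/
  ae_proportional.
Proof.
have [//|[c [e [ce nUV dom]]]] := weighted_support gf U_ge0 V_ge0; first by left.
right.
have n0 : {ae mu, forall x, c * u x + e * v x = 0}.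
  apply: ae_lin_eq0 => //.
  apply: filterS (integrable_ae measurableT iF) => x /(_ I) Fx.
  by apply: dom => //; rewrite ltey; apply/eqP => Fy; move: Fx; rewrite /F Fy.
have [UV0|UV0] := eqVneq (U + V) 0.
  have : {ae mu, forall x, 1 * u x + 1 * v x = 0}.
    apply: ae_lin_eq0; last by rewrite !mul1r.
    by apply: aeW => x; rewrite !mul1r addr_ge0.
  apply: filterS => x uv; exists 0; rewrite !mul0r.
  by have := u_ge0 x; have := v_ge0 x; split; lra.
apply: filterS n0 => x nx; exists ((u x + v x) / (U + V)).
have [] := line_proportional ce nUV nx UV0; split => //.
by rewrite divr_ge0 ?addr_ge0.
Qed.

Lemma weighted_jensen : (weighted f U V <= \int[mu]_x F x)%E.
Proof.
have [[a [b [-> Fab]]]|/weighted_integral_proportional ->//] :=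
  weighted_support_or_proportional.
rewrite -integral_lin; apply: le_integral => //; first exact: integrable_lin.
by move=> x _; exact: Fab.
Qed.

Lemma ae_eq_lin (b a : R) : weighted f U V = (b * U + a * V)%:E ->
  (forall s t, 0 <= s -> 0 <= t -> ((b * s + a * t)%:E <= weighted f s t)%E) ->
  (weighted f U V = \int[mu]_x F x)%E ->
  {ae mu, forall x, F x = (b * u x + a * v x)%:E}.
Proof.
move=> FUV Fab FI.
have : {ae mu, forall x, (F x - (b * u x + a * v x)%:E = 0)%E}.
  apply: ae_ge0_integral_eq0.
  - by apply: emeasurable_funB; [exact: measurable_weighted|
      exact: measurable_int (integrable_lin b a)].
  - by apply: aeW => x; rewrite sube_ge0 ?Fab.
  - rewrite integralB//; last exact: integrable_lin.
    by rewrite integral_lin -FI FUV subee.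
apply: filterS => x; case: (F x) => [r| |]//.
by rewrite -EFinB => -[] /eqP; rewrite subr_eq0 => /eqP ->.
Qed.

(** In the support case, the ratios r at which F is equal to the linear form
    b u + a v form an order-convex subset J of [0, +oo]: the points of the
    quadrant where F, which lies above the form, is equal to it are a convex
    cone, by subadditivity. *)
Lemma weighted_jensen_eq_affine : (weighted f U V = \int[mu]_x F x)%E ->
  exists I : interval (\bar R), affine_on f I /\
    {ae mu, forall x, 0 < v x + u x -> likelihood_ratio v u x \in I}.
Proof.
move=> FI.
have [[a [b [FUV Fab]]]|prop] := weighted_support_or_proportional; last first.
  (* the common ratio is V / U, or +oo when U = 0 *)
  have [U0|U0] := eqVneq U 0.
    exists `[+oo%E, +oo%E]; split; first by exists 0, 0 => t _; rewrite in_itv.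
    apply: filterS prop => x [s [_ us vs]] _.
    by rewrite /likelihood_ratio us U0 mulr0 eqxx in_itv/= lexx.
  have /fin_numP[FNy Fy] : weighted f U V \is a fin_num.
    by rewrite FI; exact: integrable_fin_num.
  have U_gt0 : 0 < U by rewrite lt_def U0.
  move: FNy Fy; rewrite /weighted (negbTE U0).
  case E : (at0 f (V / U)) => [r| |]; rewrite ?gt0_muley ?gt0_muleNy ?lte_fin ?eqxx// => _ _.
  exists `[(V / U)%:E, (V / U)%:E]; split.
    exists 0, r => t _; rewrite in_itv/= -eq_le => /eqP[<-].
    by rewrite E mul0r add0r.
  apply: filterS prop => x [s [s_ge0 us vs]].
  rewrite us vs -mulrDr => sUV; have s0 : s != 0.
    by apply/eqP => s0; move: sUV; rewrite s0 mul0r ltxx.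
  rewrite /likelihood_ratio us mulf_eq0 (negbTE s0) (negbTE U0)/= vs.
  by rewrite -mulf_div divff// mul1r in_itv/= lexx.
(* the ratio t stands for the direction (1, t), and +oo for (0, 1) *)
pose J (r : \bar R) : Prop := match r with
  | EFin t => 0 <= t /\ weighted f 1 t = (b + a * t)%:E
  | +oo%E => weighted f 0 1 = a%:E
  | -oo%E => False end.
have [|I IJ] := @order_convex_itv R J.
  move=> x y z Jx Jy /andP[].
  rewrite le_eqVlt => /predU1P[<-//|xz]; rewrite le_eqVlt => /predU1P[->//|].
  case: x Jx xz => [x [x0 Fx]|_|//]; last by rewrite ltNge leey.
  case: z => [z| |]//; last by move=> _; rewrite ltNge leey.
  rewrite lte_fin => xz zy.
  have z0 : 0 <= z by rewrite (le_trans x0)// ltW.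
  split => //; apply/eqP; rewrite eq_le; apply/andP; split; last first.
    by have := Fab 1 z ler01 z0; rewrite mulr1.
  case: y Jy zy => [y| |]//=.
    move=> [y0 Fy]; rewrite lte_fin => zy.
    have yx : 0 < y - x by rewrite subr_gt0 (lt_trans xz).
    have p0 : 0 <= (y - z) / (y - x) by rewrite divr_ge0 ?(ltW yx)// subr_ge0 ltW.
    have q0 : 0 <= (z - x) / (y - x) by rewrite divr_ge0 ?(ltW yx)// subr_ge0 ltW.
    have := weighted_subadditive gf (mulr_ge0 p0 ler01) (mulr_ge0 p0 x0)
      (mulr_ge0 q0 ler01) (mulr_ge0 q0 y0).
    rewrite !weightedZ Fx Fy -!EFinM -EFinD.
    rewrite (_ : (y - z) / (y - x) * 1 + _ = 1); last by field; rewrite gt_eqF.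
    rewrite (_ : (y - z) / (y - x) * x + _ = z); last by field; rewrite gt_eqF.
    by rewrite (_ : _ * (b + a * x) + _ = b + a * z)//; field; rewrite gt_eqF.
  (* (1, z) = (1, x) + (z - x) (0, 1) *)
  move=> Foo _; have zx : 0 <= z - x by rewrite subr_ge0 ltW.
  have := weighted_subadditive gf ler01 x0 (mulr_ge0 zx (lexx 0)) (mulr_ge0 zx ler01).
  rewrite !weightedZ Fx Foo -EFinM -EFinD mulr0 addr0 mulr1.
  rewrite (_ : x + (z - x) = z); last by ring.
  by rewrite (_ : b + a * x + _ = b + a * z)//; ring.
exists I; split.
  by exists a, b => t t0 /IJ[_]; rewrite at0E addrC.
apply: filterS (ae_eq_lin FUV Fab FI) => x Fx uv; apply/IJ.
rewrite /likelihood_ratio; case: eqVneq => [u0|u0] /=.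
  have v0 : 0 < v x by move: uv; rewrite u0 addr0.
  apply: (mulr_eq_EFin v0); rewrite -weightedZ mulr0 mulr1.
  by move: Fx; rewrite /F u0 mulr0 add0r mulrC.
have u_gt0 : 0 < u x by rewrite lt_neqAle eq_sym u0 u_ge0.
split; first by rewrite divr_ge0 ?(ltW u_gt0).
apply: (mulr_eq_EFin u_gt0); rewrite -weightedZ mulr1 mulrCA divff// mulr1.
by move: Fx; rewrite /F => ->; congr EFin; field.
Qed.

Lemma ae_eq0_integral : {ae mu, forall x, u x = 0} -> U = 0.
Proof.
move=> u0; apply: EFin_inj; rewrite -IU -[RHS](integral0 mu setT).
apply: ae_eq_integral => //; first exact/measurable_EFinP.
by apply: filterS u0 => x -> _.
Qed.

(** When U > 0, the mean V / U of the ratios lies in I: otherwise all of I is on one side of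
    it, and the form v - (V / U) u has constant sign and integral 0, yet is
    nonzero wherever u > 0.  If moreover I contains +oo, then f is affine up to
    infinity and its slope there is f'(oo), so that F(u, v) = b u + a v also
    where u = 0. *)
Lemma weighted_jensen_affine_eq (I : interval (\bar R)) : affine_on f I ->
  {ae mu, forall x, 0 < v x + u x -> likelihood_ratio v u x \in I} ->
  (weighted f U V = \int[mu]_x F x)%E.
Proof.
move=> [a [b fab]] ratioI.
have [U0|U0] := eqVneq U 0.
  symmetry; apply: weighted_integral_proportional.
  have u0 : {ae mu, forall x, 1 * u x + 0 * v x = 0}.
    apply: ae_lin_eq0; last by rewrite U0; ring.
    by apply: aeW => x; rewrite mul1r mul0r addr0.
  have [V0|V0] := eqVneq V 0.
    have v0 : {ae mu, forall x, 0 * u x + 1 * v x = 0}.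
      apply: ae_lin_eq0; last by rewrite V0; ring.
      by apply: aeW => x; rewrite mul1r mul0r add0r.
    apply: filterS2 u0 v0 => x ux vx; exists 0; rewrite !mul0r.
    by split=> //; lra.
  apply: filterS u0 => x ux; exists (v x / V).
  by rewrite divfK// divr_ge0// U0 mulr0; split => //; lra.
have U_gt0 : 0 < U by rewrite lt_def U0.
have lrE x : 0 < u x -> likelihood_ratio v u x = (v x / u x)%:E.
  by move=> ux; rewrite /likelihood_ratio gt_eqF.
have uvx x : 0 < u x -> 0 < v x + u x by move=> ux; rewrite ltr_wpDl.
(* since U > 0, a property true almost everywhere holds at some x with u x > 0 *)
have contra_ae (A : T -> Prop) : {ae mu, forall x, A x} ->
    exists x, A x /\ 0 < u x.
  move=> aeA; apply: contrapT => noA; move/eqP: U0; apply.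
  apply: ae_eq0_integral; apply: filterS aeA => x Ax; apply: contrapT => ux.
  by apply: noA; exists x; split => //; rewrite lt_def u_ge0 andbT; apply/eqP.
have [x0 [rI ux0]] := contra_ae _ ratioI.
move: (rI (uvx _ ux0)); rewrite lrE//; set r0 := v x0 / u x0 => {}rI.
have r0_ge0 : 0 <= r0 by rewrite divr_ge0.
have slope : +oo%E \in I -> slope_at_infinity f = a%:E.
  move=> Ioo; apply: (slope_at_infinity_affine r0_ge0) => t r0t.
  apply: fab; first exact: le_trans r0t.
  by apply: mem_itv_between rI Ioo _; rewrite lee_fin r0t leey.
set m := V / U.
have VE : V = m * U by rewrite /m divfK.
have m_ge0 : 0 <= m by rewrite divr_ge0.
have mI : m%:E \in I.
  apply: contrapT => mI.
  have [r0m|mr0|r0m] := ltgtP r0 m; last by apply: mI; rewrite -r0m.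
  - have ltm r : r \in I -> (r < m%:E)%E.
      move=> Ir; rewrite ltNge; apply/negP => mr; apply: mI.
      by apply: mem_itv_between rI Ir _; rewrite lee_fin (ltW r0m).
    have n0 : {ae mu, forall x, m * u x + (- 1) * v x = 0}.
      apply: ae_lin_eq0; last by rewrite VE; ring.
      apply: filterS ratioI => x rx; have [ux|ux] := ltP 0 (u x).
        have := ltm _ (rx (uvx _ ux)); rewrite lrE// lte_fin ltr_pdivrMr//; lra.
      have {ux} ux : u x = 0 by have := u_ge0 x; lra.
      have [vx|vx] := ltP 0 (v x); last by rewrite ux; lra.
      have := ltm _ (rx _); rewrite /likelihood_ratio ux eqxx addr0 => /(_ vx).
      by rewrite ltNge leey.
    have [x [[nx rx] ux]] := contra_ae _ (filterI n0 ratioI).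
    have := ltm _ (rx (uvx _ ux)); rewrite lrE// lte_fin ltr_pdivrMr//; lra.
  - have ltm r : r \in I -> (m%:E < r)%E.
      move=> Ir; rewrite ltNge; apply/negP => mr; apply: mI.
      by apply: mem_itv_between Ir rI _; rewrite mr lee_fin (ltW mr0).
    have n0 : {ae mu, forall x, (- m) * u x + 1 * v x = 0}.
      apply: ae_lin_eq0; last by rewrite VE; ring.
      apply: filterS ratioI => x rx; have [ux|ux] := ltP 0 (u x).
        have := ltm _ (rx (uvx _ ux)); rewrite lrE// lte_fin ltr_pdivlMr//; lra.
      have {ux} -> : u x = 0 by have := u_ge0 x; lra.
      by have := v_ge0 x; lra.
    have [x [[nx rx] ux]] := contra_ae _ (filterI n0 ratioI).
    have := ltm _ (rx (uvx _ ux)); rewrite lrE// lte_fin ltr_pdivlMr//; lra.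
rewrite {1}/weighted (negbTE U0) -/m fab// -EFinM.
rewrite (_ : U * _ = b * U + a * V); last by rewrite VE; ring.
rewrite -integral_lin; apply: ae_eq_integral => //.
- exact: measurable_int (integrable_lin b a).
- exact: measurable_weighted.
apply: filterS ratioI => x rx _; rewrite /F /weighted; case: eqVneq => [u0|u0].
  rewrite u0 mulr0 add0r; have [vx|vx] := eqVneq (v x) 0.
    by rewrite vx mulr0 mul0e.
  rewrite slope ?EFinM 1?muleC//.
  move: rx; rewrite /likelihood_ratio u0 eqxx addr0; apply.
  by rewrite lt_neqAle eq_sym vx v_ge0.
have ux : 0 < u x by rewrite lt_neqAle eq_sym u0 u_ge0.
have := rx (uvx _ ux); rewrite lrE// => rxI.
by rewrite fab ?divr_ge0// -EFinM; congr EFin; field.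
Qed.

End jensen.

(** * Densities, tests and the divergence *)

Section density.
Import HBNNSimple.
Context {R : realType} {d : measure_display} {T : measurableType d}.
Variables (lambda : {measure set T -> \bar R}) (P : probability T R) (p : T -> R).
Hypothesis hp : is_density lambda P p.

Lemma density_integral : (\int[lambda]_x (p x)%:E = 1)%E.
Proof. by have [_ _ <-//] := hp; exact: probability_setT. Qed.

Lemma density_integrable : lambda.-integrable setT (EFin \o p).
Proof.
have [mp p0 _] := hp; apply/integrableP; split; first exact/measurable_EFinP.
under eq_integral => x _ do rewrite gee0_abs ?lee_fin//.
by rewrite density_integral ltry.
Qed.

Lemma integral_density_nnsfun (s : {nnsfun T >-> R}) :
  (\int[P]_x (s x)%:E = \int[lambda]_x (s x * p x)%:E)%E.
Proof.
have [mp p0 pE] := hp.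
have preim_m (y : R) : measurable (s @^-1` [set y]) by exact: measurable_sfunP.
have term_ge0 (y : R) x : 0 <= y * \1_(s @^-1` [set y]) x * p x.
  by rewrite mulr_ge0// -lee_fin nnfun_muleindic_ge0.
rewrite integralT_nnsfun sintegralE.
under [RHS]eq_integral => x _ do rewrite fimfunE mulr_fsuml// -fsumEFin//.
rewrite ge0_integral_fsum//; last 2 first.
- move=> y; apply/measurable_EFinP; apply: measurable_funM => //.
  by apply: measurable_funM => //; exact: measurable_indic.
- by move=> y x _; rewrite lee_fin.
apply: eq_fsbigr => y _.
transitivity (y%:E * \int[lambda]_(x in s @^-1` [set y]) (p x)%:E)%E.
  by congr (_ * _)%E; exact: pE.
rewrite integral_mkcond.
transitivity (\int[lambda]_x (y%:E * (\1_(s @^-1` [set y]) x * p x)%:E))%E; last first.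
  by apply: eq_integral => x _; rewrite -EFinM mulrA.
rewrite integralZl//.
  congr (_ * _)%E; apply: eq_integral => x _; rewrite /patch indicE.
  by case: ifP => _; rewrite ?mul1r ?mul0r.
apply: le_integrable density_integrable => //.
  by apply/measurable_EFinP; apply: measurable_funM => //; exact: measurable_indic.
move=> x _ /=; rewrite lee_fin normrM ler_piMl// indicE.
by case: (_ \in _); rewrite ?normr1 ?normr0.
Qed.

(** By monotone limits of simple functions: [lambda] is an arbitrary measure, out
    of reach of the Radon-Nikodym theory of sigma-finite measures. *)
Lemma integral_density (phi : T -> R) : measurable_fun setT phi ->
  (forall x, 0 <= phi x) ->
  (\int[P]_x (phi x)%:E = \int[lambda]_x (phi x * p x)%:E)%E.
Proof.
move=> mphi phi0; have [mp p0 _] := hp.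
have mphiE : measurable_fun setT (EFin \o phi) by exact/measurable_EFinP.
pose s := nnsfun_approx measurableT mphiE.
have s_phi x : (s n x)%:E @[n --> \oo] --> (phi x)%:E.
  by apply: (cvg_nnsfun_approx measurableT mphiE) => // y _; rewrite lee_fin.
have s_nd x n m : (n <= m)%N -> s n x <= s m x.
  by move=> nm; exact/lefP/nd_nnsfun_approx.
have ms n : measurable_fun setT (s n) by exact: measurable_funP.
have -> : (\int[P]_x (phi x)%:E = lim (\int[P]_x (s n x)%:E @[n --> \oo]))%E.
  rewrite -monotone_convergence//; last 3 first.
  - by move=> n; exact/measurable_EFinP.
  - by move=> n x _; rewrite lee_fin.
  - by move=> x _ n m nm; rewrite lee_fin s_nd.
  by apply: eq_integral => x _; apply/esym/cvg_lim.
under eq_fun do rewrite integral_density_nnsfun.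
rewrite -monotone_convergence//; last 3 first.
- by move=> n; apply/measurable_EFinP; exact: measurable_funM.
- by move=> n x _; rewrite lee_fin mulr_ge0.
- by move=> x _ n m nm; rewrite lee_fin ler_wpM2r// s_nd.
apply: eq_integral => x _; apply: cvg_lim => //.
under eq_fun do rewrite EFinM.
by rewrite EFinM; apply: cvgeZr.
Qed.

Lemma integrable_density (phi : T -> R) : measurable_fun setT phi ->
  (forall x, 0 <= phi x <= 1) ->
  lambda.-integrable setT (fun x => (phi x * p x)%:E).
Proof.
move=> mphi phi01; have [mp p0 _] := hp.
apply: le_integrable density_integrable => //.
  by apply/measurable_EFinP; exact: measurable_funM.
move=> x _ /=; have /andP[phi0 phi1] := phi01 x.
by rewrite lee_fin normrM ler_piMl// ger0_norm.
Qed.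

Lemma Rintegral_density (phi : T -> R) : measurable_fun setT phi ->
  (forall x, 0 <= phi x <= 1) ->
  ((\int[P]_x phi x)%:E = \int[lambda]_x (phi x * p x)%:E)%E.
Proof.
move=> mphi phi01; rewrite /Rintegral integral_density//; last first.
  by move=> x; case/andP: (phi01 x).
by rewrite fineK//; apply: integrable_fin_num => //; exact: integrable_density.
Qed.

Lemma density_null (A : set T) : measurable A -> P A = 0%E ->
  {ae lambda, forall x, A x -> p x = 0}.
Proof.
move=> mA PA0; have [mp p0 pE] := hp.
have : {ae lambda, forall x, ((EFin \o p) \_ A) x = 0%E}.
  apply: ae_ge0_integral_eq0.
  - apply/(measurable_restrictT (EFin \o p) mA).
    by apply: measurable_funTS; exact/measurable_EFinP.
  - by apply: aeW => x; rewrite /patch; case: ifP => // _; rewrite lee_fin.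
  - by rewrite -integral_mkcond -pE.
by apply: filterS => x + Ax; rewrite /patch mem_set// => -[].
Qed.

End density.

Section tests.
Context {R : realType} {d : measure_display} {T : measurableType d}.
Variables (lambda : {measure set T -> \bar R}) (P Q : probability T R).
Variables (p q : T -> R) (f : R -> \bar R).
Hypotheses (hp : is_density lambda P p) (hq : is_density lambda Q q).
Hypothesis gf : divergence_generator f.

Let mp : measurable_fun setT p. Proof. by case: hp. Qed.
Let mq : measurable_fun setT q. Proof. by case: hq. Qed.
Let p_ge0 x : 0 <= p x. Proof. by case: hp. Qed.
Let q_ge0 x : 0 <= q x. Proof. by case: hq. Qed.

Let F x := weighted f (q x) (p x).

Let mF : measurable_fun setT F.
Proof. exact: measurable_weighted. Qed.

Let measurable_q0 : measurable [set x | q x = 0].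
Proof.
rewrite (_ : [set _ | _] = q @^-1` [set 0])//.
by rewrite -[X in measurable X]setTI; exact: mq.
Qed.

Let measurable_q_gt0 : measurable [set x | 0 < q x].
Proof.
rewrite (_ : [set _ | _] = ~` [set x | q x = 0]); first exact: measurableC.
apply/seteqP; split=> x /=; first by move=> + q0; rewrite q0 ltxx.
by move=> /eqP q0; rewrite lt_neqAle eq_sym q0 q_ge0.
Qed.

(** On q = 0 the integrand F(q, p) is p f'(oo), whose integral is the singular
    term. *)
Lemma f_divE : f_div lambda P p q f = (\int[lambda]_x F x)%E.
Proof.
have -> : [set: T] = [set x | 0 < q x] `|` [set x | q x = 0].
  apply/seteqP; split=> x //= _; have := q_ge0 x; rewrite le_eqVlt => /predU1P[<-|].
    by right.
  by left.
rewrite integral_setU//; last 2 first.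
- exact: measurable_funTS.
- by apply/disj_set2P/seteqP; split => x //= [+ q0]; rewrite q0 ltxx.
congr (_ + _)%E.
  apply: eq_integral => x; rewrite inE/= => q0.
  by rewrite /F /weighted gt_eqF// muleC.
have [_ _ pE] := hp; rewrite pE//.
rewrite -integralZl_nNy//.
- by apply: eq_integral => x; rewrite inE/= => q0; rewrite /F /weighted q0 eqxx muleC.
- by rewrite slope_at_infinity_weighted; apply: weighted_ninfty.
- exact: integrableS (density_integrable hp).
Qed.

Lemma f_div_integrable : (f_div lambda P p q f < +oo)%E ->
  lambda.-integrable setT F.
Proof.
rewrite f_divE => Foo; have [a [b fab]] := generator_affine_minorant gf.
apply: (integrable_bounded_below (l := fun x => b * q x + a * p x)) => //.
  by apply: integrable_lin; [exact: density_integrable hq|exact: density_integrable hp].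
by move=> x; exact: weighted_ge_affine.
Qed.

Section one_test.
Variable phi : T -> R.
Hypothesis tphi : is_test phi.

Let mphi : measurable_fun setT phi. Proof. by case: tphi. Qed.
Let phi01 x : 0 <= phi x <= 1. Proof. by case: tphi. Qed.

Lemma is_test_compl : is_test (fun x => 1 - phi x).
Proof.
split; first exact: measurable_funB.
by move=> x; have /andP[? ?] := phi01 x; rewrite subr_ge0 lerBlDr lerDl; apply/andP.
Qed.

Lemma Rintegral_compl (P' : probability T R) (p' : T -> R) :
  is_density lambda P' p' ->
  \int[P']_x (1 - phi x) = 1 - \int[P']_x phi x.
Proof.
move=> hp'; apply: EFin_inj.
have [m1 b1] := is_test_compl.
rewrite EFinB (Rintegral_density hp')// (Rintegral_density hp')//.
rewrite -(density_integral hp') -integralB//; last 2 first.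
- exact: density_integrable hp'.
- exact: integrable_density hp' _ _ _.
by apply: eq_integral => x _; rewrite mulrBl mul1r EFinB.
Qed.

Lemma weighted_test_integrable : lambda.-integrable setT F ->
  lambda.-integrable setT (fun x => weighted f (phi x * q x) (phi x * p x)).
Proof.
move=> iF; apply: le_integrable iF => //.
  apply: measurable_weighted => //; [exact: measurable_funM|exact: measurable_funM| |];
    by move=> x; have /andP[phi0 _] := phi01 x; rewrite mulr_ge0.
move=> x _; rewrite weightedZ abseM; have /andP[phi0 phi1] := phi01 x.
by rewrite -[leRHS]mul1e lee_wpmul2r//= lee_fin ger0_norm.
Qed.

End one_test.

(** F is positively homogeneous, so F(q, p) is distributed between the two
    outcomes of the test in the proportions phi and 1 - phi. *)
Lemma f_div_split (phi : T -> R) : is_test phi -> lambda.-integrable setT F ->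
  (f_div lambda P p q f =
    \int[lambda]_x weighted f (phi x * q x)%R (phi x * p x)%R +
    \int[lambda]_x weighted f ((1 - phi x) * q x)%R ((1 - phi x) * p x)%R)%E.
Proof.
move=> tphi iF; rewrite f_divE -integralD//; last 2 first.
- exact: weighted_test_integrable.
- by apply: weighted_test_integrable => //; exact: is_test_compl.
apply: eq_integral => x _; rewrite !weightedZ.
have [_ /(_ x) /andP[phi0 phi1]] := tphi.
rewrite -ge0_muleDl ?lee_fin ?subr_ge0//.
by rewrite -EFinD addrC subrK mul1e.
Qed.

Lemma weighted_test_le (phi : T -> R) : is_test phi -> lambda.-integrable setT F ->
  (weighted f (\int[Q]_x phi x)%R (\int[P]_x phi x)%R <=
    \int[lambda]_x weighted f (phi x * q x)%R (phi x * p x)%R)%E.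
Proof.
move=> tphi iF; have [mphi phi01] := tphi.
apply: weighted_jensen => //.
- by move=> x; have /andP[phi0 _] := phi01 x; rewrite mulr_ge0.
- by move=> x; have /andP[phi0 _] := phi01 x; rewrite mulr_ge0.
- exact: integrable_density hq _ _ _.
- exact: integrable_density hp _ _ _.
- by rewrite -(Rintegral_density hq).
- by rewrite -(Rintegral_density hp).
- exact: weighted_test_integrable.
Qed.

(** Jensen's inequality on each outcome of the test; there is nothing to prove
    when D_f is infinite, and otherwise F(q, p) is integrable. *)
Lemma np_region_sub : np_region P Q `<=`
  [set ab | [/\ 0 <= ab.1 <= 1, 0 <= ab.2 <= 1 &
          (test_div f ab <= f_div lambda P p q f)%E]].
Proof.
have int01 (P' : probability T R) (p' phi : T -> R) : is_density lambda P' p' ->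
    is_test phi -> 0 <= \int[P']_x phi x <= 1.
  move=> hp' tphi; have [mphi phi01] := tphi.
  have ge0 psi : is_test psi -> 0 <= \int[P']_x psi x.
    by move=> [_ psi01]; apply: Rintegral_ge0 => x _; case/andP: (psi01 x).
  rewrite ge0//= -subr_ge0 -(Rintegral_compl _ hp')//.
  by apply: ge0; exact: is_test_compl.
move=> _ [phi [tphi ->]]/=; have tphi' := is_test_compl tphi.
split; [exact: int01 hq _|exact: int01 hp _|].
have [Doo|] := eqVneq (f_div lambda P p q f) +oo%E; first by rewrite Doo leey.
rewrite -ltey => /f_div_integrable iF.
rewrite (f_div_split tphi iF) /test_div/=.
rewrite (Rintegral_compl tphi hq) subKr -(Rintegral_compl tphi hp) -(Rintegral_compl tphi hq).
by apply: leeD; exact: weighted_test_le.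
Qed.

End tests.

Section convexity.
Context {R : realType}.
Variable f : R -> \bar R.
Hypothesis gf : divergence_generator f.

Lemma weighted_convex (s s' u1 v1 u2 v2 : R) : 0 <= s -> 0 <= s' ->
  0 <= u1 -> 0 <= v1 -> 0 <= u2 -> 0 <= v2 ->
  (weighted f (s * u1 + s' * u2)%R (s * v1 + s' * v2)%R <=
   s%:E * weighted f u1 v1 + s'%:E * weighted f u2 v2)%E.
Proof.
move=> *; rewrite -!weightedZ.
by apply: weighted_subadditive => //; exact: mulr_ge0.
Qed.

(** [test_div] is a sum of two values of F at affine functions of
    (alpha, beta).  Averaging D with itself gives D also when D is infinite. *)
Lemma test_div_sublevel_convex (D : \bar R) :
  convex_set ([set ab | [/\ 0 <= ab.1 <= 1, 0 <= ab.2 <= 1 &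
          (test_div f ab <= D)%E]] : set (R^o * R^o)).
Proof.
move=> [a b] [a' b'] s; rewrite !inE/= => -[a01 b01 abD] [a01' b01' abD'].
have s1_ge0 : 0 <= s%:num by exact: ge0.
have s2_ge0 : 0 <= 1 - s%:num by rewrite subr_ge0; exact: le1.
set s1 := s%:num in s1_ge0 s2_ge0; set s2 := 1 - s1 in s2_ge0.
have conv01 x y : 0 <= x <= 1 -> 0 <= y <= 1 -> 0 <= s1 * x + s2 * y <= 1.
  move=> /andP[x0 x1] /andP[y0 y1]; rewrite addr_ge0 ?mulr_ge0//=.
  have -> : 1 = s1 * 1 + s2 * 1 by rewrite /s2; ring.
  by rewrite lerD// ler_wpM2l.
split; [exact: conv01 a01 a01'|exact: conv01 b01 b01'|].
suff : (test_div f (s1 * a + s2 * a', s1 * b + s2 * b')%R <= D)%E by [].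
move: a01 b01 a01' b01' => /andP[a0 a1] /andP[b0 b1] /andP[a0' a1'] /andP[b0' b1'].
have DE : (s1%:E * D + s2%:E * D = D)%E.
  by rewrite -ge0_muleDl ?lee_fin// -EFinD addrC subrK mul1e.
have s1_le1 : s1 <= 1 by rewrite -subr_ge0.
have s1E : (0 <= s1%:E)%E by rewrite lee_fin.
have s2E : (0 <= s2%:E)%E by rewrite lee_fin.
rewrite -DE; apply: le_trans (leeD (lee_wpmul2l s1E abD) (lee_wpmul2l s2E abD')).
rewrite /test_div/=.
have gtNy x y : 0 <= x -> 0 <= y -> weighted f x y \in [pred z | -oo < z]%E.
  by move=> *; rewrite inE; exact: weighted_ninfty.
rewrite !muleDr ?fin_numE//; last 2 first.
- by apply: ltninfty_adde_def; apply: gtNy; rewrite ?subr_ge0.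
- by apply: ltninfty_adde_def; apply: gtNy; rewrite ?subr_ge0.
have compl x y : 1 - (s1 * x + s2 * y) = s1 * (1 - x) + s2 * (1 - y).
  by rewrite /s2; ring.
rewrite addeACA !compl; apply: leeD; apply: weighted_convex; rewrite ?subr_ge0//.
Qed.

End convexity.

(** * The Neyman-Pearson lemma *)

Section neyman_pearson.
Context {R : realType} {d : measure_display} {T : measurableType d}.
Variables (lambda : {measure set T -> \bar R}) (P Q : probability T R).
Variables (p q : T -> R).
Hypotheses (hp : is_density lambda P p) (hq : is_density lambda Q q).
Variables (E : set T) (alpha beta : R).
Hypotheses (mE : measurable E) (QE : Q E = alpha%:E) (PE : P (~` E) = beta%:E).
Hypothesis bdE : np_boundary P Q (alpha, beta).

Let mp : measurable_fun setT p. Proof. by case: hp. Qed.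
Let mq : measurable_fun setT q. Proof. by case: hq. Qed.
Let p_ge0 x : 0 <= p x. Proof. by case: hp. Qed.
Let q_ge0 x : 0 <= q x. Proof. by case: hq. Qed.

(** The test that accepts Q with probability b on A, 1 - a on B, and like E
    elsewhere, has the false positive rate of E because b Q(A) = a Q(B), so its
    false negative rate is at least beta. *)
Lemma np_swap (A B : set T) (a b : R) : measurable A -> measurable B ->
  A `<=` E -> B `<=` ~` E -> 0 <= a <= 1 -> 0 <= b <= 1 ->
  b * fine (Q A) = a * fine (Q B) -> a * fine (P B) <= b * fine (P A).
Proof.
move=> mA mB AE BE /andP[a0 a1] /andP[b0 b1] Qab.
have mEc : measurable (~` E) by exact: measurableC.
pose phi x : R := \1_(~` E) x + (b * \1_A x - a * \1_B x).
have intg (P' : probability T R) : \int[P']_x phi x =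
    fine (P' (~` E)) + (b * fine (P' A) - a * fine (P' B)).
  have ii (X : set T) : measurable X -> P'.-integrable setT (EFin \o (\1_X : T -> R)).
    by move=> mX; exact: integrable_indic.
  have ic (X : set T) (c : R) : measurable X ->
      P'.-integrable setT (EFin \o (fun x => c * \1_X x)).
    by move=> mX; apply: eq_integrable (integrableZl measurableT c (ii _ mX)).
  have RI (X : set T) : measurable X -> \int[P']_x (\1_X x : R) = fine (P' X).
    by move=> mX; rewrite /Rintegral integral_indic// setIT.
  rewrite RintegralD//; [|exact: ii|]; last first.
    by have := integrableB measurableT (ic A b mA) (ic B a mB); exact: eq_integrable.
  rewrite RintegralB//; [|exact: ic|exact: ic].
  by rewrite !RintegralZl// ?RI//; exact: ii.
have tphi : is_test phi.
  split.
    apply: measurable_funD; first exact: measurable_indic.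
    by apply: measurable_funB; apply: measurable_funM => //; exact: measurable_indic.
  move=> x; rewrite /phi !indicE.
  have [xE|xE] := pselect (E x).
    rewrite (memNset (A := ~` E))// (memNset (A := B)); last by move/BE.
    by case: (x \in A); rewrite /=; lra.
  rewrite (mem_set (A := ~` E))// (memNset (A := A)); last by move/AE.
  by case: (x \in B); rewrite /=; lra.
have reg : np_region P Q (alpha, \int[P]_x phi x).
  exists phi; split => //=; congr pair.
  rewrite (Rintegral_compl tphi hq) intg Qab subrr addr0.
  by rewrite probability_setC// QE -EFinB /=; ring.
by have [_ /(_ _ reg)/=] := bdE; rewrite intg PE/=; lra.
Qed.

(** Moving all of B = ~` E `&` [q = 0] into E leaves alpha unchanged and lowers
    beta by P(B). *)
Lemma np_singular : {ae lambda, forall x, ~ E x -> q x = 0 -> p x = 0}.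
Proof.
have mB : measurable (~` E `&` [set x | q x = 0]).
  apply: measurableI; first exact: measurableC.
  rewrite (_ : [set _ | _] = q @^-1` [set 0])//.
  by rewrite -[X in measurable X]setTI; exact: mq.
have QB : Q (~` E `&` [set x | q x = 0]) = 0%E.
  have [_ _ qE] := hq; rewrite qE//; apply: integral0_eq => x [_ /= ->] //.
have : fine (P (~` E `&` [set x | q x = 0])) <= 0.
  rewrite -[leLHS]mul1r -[leRHS](mul0r (fine (P set0))).
  apply: np_swap => //; rewrite ?lexx ?ler01//.
  by rewrite QB mulr0 mul0r.
move=> PB; have {PB} : P (~` E `&` [set x | q x = 0]) = 0%E.
  apply/eqP; rewrite eq_le measure_ge0 andbT -[leLHS]fineK ?lee_fin//.
  exact: fin_num_measure.
by move/(density_null hp mB); apply: filterS => x px nE q0; apply: px.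
Qed.

(** If A = E `&` [p < c q] and B = ~` E `&` [p > c q] both had positive Q-mass,
    exchange them with a = Q(A) and b = Q(B): then
    Q(A) P(B) <= Q(B) P(A) <= c Q(A) Q(B), so P(B) <= c Q(B), although
    p > c q on B. *)
Lemma np_level (c : R) :
  {ae lambda, forall x, E x -> 0 < q x -> c * q x <= p x} \/
  {ae lambda, forall x, ~ E x -> 0 < q x -> p x <= c * q x}.
Proof.
have mcq : measurable_fun setT (fun x => c * q x) by exact: measurable_funM.
have mlt (g h : T -> R) : measurable_fun setT g -> measurable_fun setT h ->
    measurable [set x | g x < h x].
  move=> mg mh; have /(_ measurableT [set true] I) := measurable_fun_ltr mg mh.
  by rewrite setTI.
pose A := E `&` ([set x | p x < c * q x] `&` [set x | 0 < q x]).
pose B := ~` E `&` ([set x | c * q x < p x] `&` [set x | 0 < q x]).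
have mA : measurable A by do 2?apply: measurableI => //; exact: mlt.
have mB : measurable B.
  by apply: measurableI; [exact: measurableC|apply: measurableI; exact: mlt].
have QfE (X : set T) : measurable X -> Q X = (fine (Q X))%:E.
  by move=> mX; rewrite fineK//; exact: fin_num_measure.
have PfE (X : set T) : measurable X -> P X = (fine (P X))%:E.
  by move=> mX; rewrite fineK//; exact: fin_num_measure.
have [QA0|QA0] := eqVneq (Q A) 0%E.
  left; apply: filterS (density_null hq mA QA0) => x Ax Ex qx.
  rewrite leNgt; apply/negP => pcq; have : q x = 0 by apply: Ax.
  by apply/eqP; rewrite gt_eqF.
have [QB0|QB0] := eqVneq (Q B) 0%E.
  right; apply: filterS (density_null hq mB QB0) => x Bx Ex qx.
  rewrite leNgt; apply/negP => pcq; have : q x = 0 by apply: Bx.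
  by apply/eqP; rewrite gt_eqF.
exfalso.
have qA : 0 < fine (Q A).
  by rewrite fine_gt0// lt_neqAle eq_sym QA0 measure_ge0/= ltey_eq fin_num_measure.
have qB : 0 < fine (Q B).
  by rewrite fine_gt0// lt_neqAle eq_sym QB0 measure_ge0/= ltey_eq fin_num_measure.
have fine1 (X : set T) : measurable X -> fine (Q X) <= 1.
  by move=> mX; rewrite -lee_fin -QfE//; exact: probability_le1.
have swap : fine (Q A) * fine (P B) <= fine (Q B) * fine (P A).
  apply: np_swap => //; rewrite ?fine_ge0 ?fine1//; try by move=> x [].
  by rewrite mulrC.
have ip := density_integrable hp; have iq := density_integrable hq.
have ipc (k : R) (X : set T) : measurable X ->
    lambda.-integrable X (fun x => (k * q x)%:E).
  by move=> mX; apply: integrableS (integrableZl measurableT k iq).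
have Ic (X : set T) (k : R) : measurable X ->
    (\int[lambda]_(x in X) (k * q x)%:E = (k * fine (Q X))%:E)%E.
  move=> mX; have [_ _ qE] := hq.
  rewrite EFinM -QfE// qE// -integralZl//.
  exact: integrableS iq.
have PA : fine (P A) <= c * fine (Q A).
  rewrite -lee_fin -PfE// -Ic//; have [_ _ pE] := hp; rewrite pE//.
  apply: le_integral => //; first exact: integrableS ip.
    exact: ipc.
  by move=> x; rewrite inE => -[_ [/= + _]]; rewrite lee_fin => /ltW.
have PB : fine (P B) <= c * fine (Q B).
  rewrite -(ler_pM2l qA); apply: le_trans swap _.
  rewrite [leRHS](_ : _ = fine (Q B) * (c * fine (Q A))); last by ring.
  by rewrite ler_pM2l.
have IB : (\int[lambda]_(x in B) (p x - c * q x)%:E = (fine (P B) - c * fine (Q B))%:E)%E.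
  rewrite EFinB -PfE// -Ic//; have [_ _ pE] := hp; rewrite pE// -integralB//.
    exact: integrableS ip.
  exact: ipc.
have IB0 : (\int[lambda]_(x in B) (p x - c * q x)%:E = 0)%E.
  apply/eqP; rewrite eq_le; apply/andP; split.
    by rewrite IB lee_fin subr_le0.
  by apply: integral_ge0 => x [_ [/= cp _]]; rewrite lee_fin subr_ge0 ltW.
have nB : {ae lambda, forall x, ((fun x => (p x - c * q x)%:E) \_ B) x = 0%E}.
  apply: ae_ge0_integral_eq0.
  - apply/(measurable_restrictT _ mB); apply: measurable_funTS.
    by apply/measurable_EFinP; exact: measurable_funB.
  - apply: aeW => x; rewrite /patch; case: ifPn => //; rewrite inE => -[_ [/= cp _]].
    by rewrite lee_fin subr_ge0 ltW.
  - by rewrite -integral_mkcond.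
move/eqP: QB0; apply; have [_ _ qE] := hq; rewrite qE// integral_mkcond.
rewrite -[RHS](integral0 lambda setT); apply: ae_eq_integral => //.
  apply/(measurable_restrictT _ mB); apply: measurable_funTS.
  exact/measurable_EFinP.
apply: filterS nB => x + _; rewrite /patch; case: ifPn => //.
rewrite inE => -[_ [/= cp _]] [/eqP]; rewrite subr_eq0 => /eqP pc.
by move: cp; rewrite pc ltxx.
Qed.

(** Levels are restricted to rational numbers so that the null sets of
    [np_level] can be united. *)
Lemma np_threshold : exists t0 : \bar R, (0 <= t0)%E /\
  {ae lambda, forall x, 0 < q x ->
           ((t0 < (p x / q x)%R%:E)%E -> E x) /\
           (E x -> (t0 <= (p x / q x)%R%:E)%E)}.
Proof.
pose S := [set c : rat |
  {ae lambda, forall x, E x -> 0 < q x -> ratr c * q x <= p x}].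
pose t0 := ereal_sup [set (ratr c : R)%:E | c in S].
exists t0; split.
  apply: ereal_sup_ubound; exists 0; rewrite ?rmorph0//.
  by apply: aeW => x _ _; rewrite rmorph0 mul0r.
pose G (c : rat) x := 0 < q x ->
  (S c -> E x -> ratr c * q x <= p x) /\ (~ S c -> ~ E x -> p x <= ratr c * q x).
have aeG c : {ae lambda, forall x, G c x}.
  have [Sc|nSc] := pselect (S c).
    by apply: filterS (Sc) => x h qx; split => [_ Ex|/(_ Sc)//]; exact: h.
  have [//|] := np_level (ratr c).
  by apply: filterS => x h qx; split => [/nSc//|_ Ex]; exact: h.
have : {ae lambda, forall x, forall n, if unpickle n is Some c then G c x else True}.
  by apply: ae_foralln => n; case: unpickle => [c|]; [exact: aeG|exact: aeW].
apply: filterS => x Gx qx.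
have {}Gx c : (S c -> E x -> ratr c * q x <= p x) /\ (~ S c -> ~ E x -> p x <= ratr c * q x).
  by have := Gx (pickle c); rewrite pickleK; apply.
split => [t0r|Ex].
  apply: contrapT => nEx.
  have t0_ge0 : (0 <= t0)%E.
    apply: ereal_sup_ubound; exists 0; rewrite ?rmorph0//.
    by apply: aeW => y _ _; rewrite rmorph0 mul0r.
  move: t0r t0_ge0; case E0 : t0 => [r| |]//; rewrite lte_fin => rpq _.
  have [c] := rat_in_itvoo rpq; rewrite in_itv/= => /andP[rc cpq].
  have nSc : ~ S c.
    move=> Sc; have : ((ratr c : R)%:E <= t0)%E by apply: ereal_sup_ubound; exists c.
    by rewrite E0 lee_fin leNgt rc.
  have := (Gx c).2 nSc nEx; rewrite leNgt => /negP; apply.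
  by rewrite -ltr_pdivlMr.
apply: ge_ereal_sup => _ [c Sc <-].
by rewrite lee_fin ler_pdivlMr//; apply: (Gx c).1.
Qed.

End neyman_pearson.

(** * The equality condition *)

Section equality.
Context {R : realType} {d : measure_display} {T : measurableType d}.
Variables (lambda : {measure set T -> \bar R}) (P Q : probability T R).
Variables (p q : T -> R) (f : R -> \bar R).
Hypotheses (hp : is_density lambda P p) (hq : is_density lambda Q q).
Hypothesis gf : divergence_generator f.
Hypothesis iF : lambda.-integrable setT (fun x => weighted f (q x) (p x)).

Let p_ge0 x : 0 <= p x. Proof. by case: hp. Qed.
Let q_ge0 x : 0 <= q x. Proof. by case: hq. Qed.

(** The part of D_f carried by A.  Cutting with indicator functions rather than
    by restricting the measure lets Jensen's inequality apply as it stands. *)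
Let cell A := (\int[lambda]_x weighted f (\1_A x * q x)%R (\1_A x * p x)%R)%E.

Lemma is_test_indic (A : set T) : measurable A -> is_test (\1_A : T -> R).
Proof.
move=> mA; split; first exact: measurable_indic.
by move=> x; rewrite indicE; case: (_ \in _); rewrite ?lexx ?ler01.
Qed.

Lemma Rintegral_indic_probability (P' : probability T R) (A : set T) :
  measurable A -> \int[P']_x (\1_A x : R) = fine (P' A).
Proof. by move=> mA; rewrite /Rintegral integral_indic// setIT. Qed.

Lemma cell_equality (A : set T) : measurable A ->
  weighted f (fine (Q A)) (fine (P A)) = cell A <->
  exists I : interval (\bar R), affine_on f I /\
    {ae lambda, forall x, 0 < p x + q x -> A x -> likelihood_ratio p q x \in I}.
Proof.
move=> mA; have tA := is_test_indic mA; have [mI I01] := tA.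
have u0 x : 0 <= (\1_A x : R) * q x by have /andP[? _] := I01 x; rewrite mulr_ge0.
have v0 x : 0 <= (\1_A x : R) * p x by have /andP[? _] := I01 x; rewrite mulr_ge0.
have iu := integrable_density hq mI I01; have iv := integrable_density hp mI I01.
have IU : (\int[lambda]_x (\1_A x * q x)%:E = (fine (Q A))%:E)%E.
  by rewrite -(Rintegral_density hq)// Rintegral_indic_probability.
have IV : (\int[lambda]_x (\1_A x * p x)%:E = (fine (P A))%:E)%E.
  by rewrite -(Rintegral_density hp)// Rintegral_indic_probability.
have iFA := weighted_test_integrable hp hq gf tA iF.
have onA (I : interval (\bar R)) :
  {ae lambda, forall x, 0 < \1_A x * p x + \1_A x * q x ->
    likelihood_ratio (fun x => \1_A x * p x) (fun x => \1_A x * q x) x \in I} <->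
  {ae lambda, forall x, 0 < p x + q x -> A x -> likelihood_ratio p q x \in I}.
  split; apply: filterS => x h.
    move=> pq Ax; move: h; rewrite /likelihood_ratio indicE mem_set// !mul1r.
    exact.
  rewrite /likelihood_ratio indicE; have [Ax|nAx] := pselect (A x).
    by rewrite mem_set// !mul1r => pq; exact: h.
  by rewrite memNset// !mul0r addr0 ltxx.
split=> [eqA|[I [fI /onA ratI]]].
  have [I [fI /onA ratI]] := weighted_jensen_eq_affine gf u0 v0 iu iv IU IV iFA eqA.
  by exists I.
have := weighted_jensen_affine_eq gf u0 v0 iu iv IU IV fI.
exact.
Qed.

Variables (E : set T) (alpha beta : R).
Hypotheses (mE : measurable E) (QE : Q E = alpha%:E) (PE : P (~` E) = beta%:E).

Let mEc : measurable (~` E). Proof. exact: measurableC. Qed.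

Lemma test_div_cells :
  test_div f (alpha, beta) = (weighted f (fine (Q (~` E))) (fine (P (~` E))) +
    weighted f (fine (Q E)) (fine (P E)))%E.
Proof.
rewrite /test_div/= QE PE/=.
have -> : fine (Q (~` E)) = 1 - alpha by rewrite probability_setC// QE.
by have -> : fine (P E) = 1 - beta by rewrite -[E]setCK probability_setC// PE.
Qed.

Lemma f_div_cells : f_div lambda P p q f = (cell (~` E) + cell E)%E.
Proof.
rewrite (f_div_split hp hq gf (is_test_indic mEc) iF); congr (_ + _)%E.
apply: eq_integral => x _.
suff -> : 1 - \1_(~` E) x = \1_E x :> R by [].
rewrite !indicE in_setC; case: (_ \in _); rewrite ?subr0 ?subrr//.
Qed.

(** Each of the two terms is bounded by its cell, and all quantities are finite,
    so the sums agree only if the terms do. *)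
Lemma test_div_eq_cells : test_div f (alpha, beta) = f_div lambda P p q f <->
  weighted f (fine (Q (~` E))) (fine (P (~` E))) = cell (~` E) /\
  weighted f (fine (Q E)) (fine (P E)) = cell E.
Proof.
have cell_fin A : measurable A -> cell A \is a fin_num.
  move=> mA; apply: integrable_fin_num => //.
  exact: (weighted_test_integrable hp hq gf (is_test_indic mA) iF).
have le_cell A : measurable A -> (weighted f (fine (Q A)) (fine (P A)) <= cell A)%E.
  move=> mA; have := weighted_test_le hp hq gf (is_test_indic mA) iF.
  by rewrite !Rintegral_indic_probability.
have gtNy A : (-oo < weighted f (fine (Q A)) (fine (P A)))%E.
  by apply: weighted_ninfty => //; exact: fine_ge0.
rewrite test_div_cells f_div_cells; split => [|[-> ->]//].
move: (cell_fin _ mE) (cell_fin _ mEc) (le_cell _ mE) (le_cell _ mEc) (gtNy E) (gtNy (~` E)).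
case: (cell E) (cell (~` E)) => [r| |]// [r'| |]// _ _.
case: (weighted _ _ _) (weighted _ _ _) => [s| |]// [s'| |]//.
rewrite !lee_fin -!EFinD => ? ? _ _ [?]; split; congr EFin; lra.
Qed.

Lemma equality_condition_eq : equality_condition lambda p q f E ->
  test_div f (alpha, beta) = f_div lambda P p q f.
Proof.
move=> [t0 [I0 [I1 [_ _ ratI [fI0 fI1]]]]]; apply/test_div_eq_cells; split.
  by apply/cell_equality => //; exists I0; split => //;
    apply: filterS ratI => x h pq nEx; exact: (h pq).1.
by apply/cell_equality => //; exists I1; split => //;
  apply: filterS ratI => x h pq Ex; exact: (h pq).2.
Qed.

Lemma affine_on_sub (I J : interval (\bar R)) :
  {subset I <= J} -> affine_on f J -> affine_on f I.
Proof. by move=> IJ [a [b fJ]]; exists a, b => t t0 /IJ; exact: fJ. Qed.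

Hypothesis bdE : np_boundary P Q (alpha, beta).

(** The intervals of the two cells are cut at the Neyman-Pearson threshold, which
    almost no ratio crosses.  On q = 0 the ratio is +oo and the point belongs to
    E, up to a null set, by [np_singular]. *)
Lemma eq_equality_condition : test_div f (alpha, beta) = f_div lambda P p q f ->
  equality_condition lambda p q f E.
Proof.
move=> /test_div_eq_cells[/(cell_equality mEc)[I0 [fI0 ratI0]]].
move=> /(cell_equality mE)[I1 [fI1 ratI1]].
have [t0 [t0_ge0 threshold]] := np_threshold hp hq mE QE PE bdE.
exists t0, (I0 `&` `[0%E, t0])%O, (I1 `&` `[t0, +oo%E])%O.
have subr (I J : interval (\bar R)) : {subset (I `&` J)%O <= J}.
  by move=> x; rewrite in_itvI => /andP[].
have subl (I J : interval (\bar R)) : {subset (I `&` J)%O <= I}.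
  by move=> x; rewrite in_itvI => /andP[].
split => //.
- apply: filterS3 threshold (filterI ratI0 ratI1) (np_singular hp hq mE QE PE bdE).
  move=> x thr [rat0 rat1] sing pq; split => [nEx|Ex].
    rewrite in_itvI (rat0 pq nEx)/= in_itv/= /likelihood_ratio.
    case: eqVneq => [q0|q0].
      by move: pq; rewrite q0 addr0 (sing nEx q0) ltxx.
    have qx : 0 < q x by rewrite lt_neqAle eq_sym q0 q_ge0.
    rewrite lee_fin divr_ge0//= leNgt; apply/negP => /((thr qx).1).
    exact: nEx.
  rewrite in_itvI (rat1 pq Ex)/= in_itv/= leey andbT /likelihood_ratio.
  case: eqVneq => [q0|q0]; first by rewrite leey.
  have qx : 0 < q x by rewrite lt_neqAle eq_sym q0 q_ge0.
  exact: (thr qx).2.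
- by split; [exact: affine_on_sub fI0|exact: affine_on_sub fI1].
Qed.

End equality.

Section piecewise_linear.
Context {R : realType}.
Variables (f : R -> \bar R) (t0 : R).
Hypotheses (t0_gt0 : 0 < t0) (gf : divergence_generator f).
Hypothesis fpl : piecewise_linear f t0.

Lemma piecewise_linear_affine :
  affine_on f `[0%E, t0%:E] /\ affine_on f `[t0%:E, +oo%E].
Proof.
have [a0 [a1 [c [_ fE]]]] := fpl; split.
  exists a0, (c - a0 * t0) => t; rewrite le_eqVlt => /predU1P[<- _|t_gt0].
    rewrite mulr0 add0r; apply: (at0_eq_affine (a := a0) t0_gt0) => s /andP[s_gt0 st0].
    by rewrite fE// (ltW st0); congr EFin; ring.
  rewrite in_itv/= => /andP[_]; rewrite lee_fin => tt0.
  by rewrite /at0 gt_eqF// fE// tt0; congr EFin; ring.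
exists a1, (c - a1 * t0) => t _; rewrite in_itv/= leey andbT lee_fin => tt0.
have t_gt0 : 0 < t := lt_le_trans t0_gt0 tt0.
rewrite /at0 gt_eqF// fE//; congr EFin; case: ifPn => [tt0'|_]; last by ring.
have -> : t = t0 by apply/eqP; rewrite eq_le tt0 tt0'.
ring.
Qed.

(** With [generator_affine_minorant] this makes D_f finite. *)
Lemma piecewise_linear_bound : exists b a : R, forall u v, 0 <= u -> 0 <= v ->
  (weighted f u v <= (b * u + a * v)%:E)%E.
Proof.
have [[a0 [b0 f0]] [a1 [b1 f1]]] := piecewise_linear_affine.
exists (`|b0| + `|b1|), (`|a0| + `|a1|) => u v u_ge0 v_ge0.
have slope : slope_at_infinity f = a1%:E.
  apply: (slope_at_infinity_affine (ltW t0_gt0)) => t tt0.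
  by apply: f1; rewrite ?(le_trans (ltW t0_gt0))// in_itv/= leey andbT lee_fin.
have leb (a b : R) w : 0 <= w -> a * w <= (`|a| + `|b|) * w.
  move=> w0; rewrite ler_wpM2r//; apply: le_trans (ler_norm a) _.
  by rewrite lerDl.
have lebr (a b : R) w : 0 <= w -> a * w <= (`|b| + `|a|) * w.
  by move=> w0; rewrite [leRHS](_ : _ = (`|a| + `|b|) * w) ?leb//; ring.
rewrite /weighted; case: eqVneq => [->|u_neq0].
  by rewrite mulr0 add0r slope -EFinM lee_fin mulrC lebr.
have u_gt0 : 0 < u by rewrite lt_neqAle eq_sym u_neq0.
have vu_ge0 : 0 <= v / u by rewrite divr_ge0.
have [vut0|vut0] := leP (v / u) t0.
  rewrite f0//; last by rewrite in_itv/= !lee_fin vu_ge0.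
  rewrite -EFinM lee_fin.
  rewrite (_ : u * _ = b0 * u + a0 * v); last by field.
  by rewrite lerD// leb.
rewrite f1//; last by rewrite in_itv/= leey andbT lee_fin ltW.
rewrite -EFinM lee_fin.
rewrite (_ : u * _ = b1 * u + a1 * v); last by field.
by rewrite lerD// lebr.
Qed.

End piecewise_linear.

Theorem theorem1 (R : realType) (d : measure_display) (T : measurableType d)
    (lambda : {measure set T -> \bar R}) (P Q : probability T R)
    (p q : T -> R) (hp : is_density lambda P p) (hq : is_density lambda Q q)
    (f : R -> \bar R) (hf : divergence_generator f) :
  [/\ forall (E : set T) (alpha beta : R),
        measurable E -> Q E = alpha%:E -> P (~` E) = beta%:E ->
        np_boundary P Q (alpha, beta) ->
        [/\ (test_div f (alpha, beta) <= f_div lambda P p q f)%E,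
            forall t0 : R, 0 < t0 -> piecewise_linear f t0 ->
              E `&` [set x | 0 < q x] = [set x | 0 < q x /\ t0 < p x / q x] ->
              test_div f (alpha, beta) = f_div lambda P p q f &
            (f_div lambda P p q f < +oo)%E ->
              (test_div f (alpha, beta) = f_div lambda P p q f <->
               equality_condition lambda p q f E)],
      convex_set ([set ab | [/\ 0 <= ab.1 <= 1, 0 <= ab.2 <= 1 &
          (test_div f ab <= f_div lambda P p q f)%E]] : set (R^o * R^o)) &
      np_region P Q `<=`
        [set ab | [/\ 0 <= ab.1 <= 1, 0 <= ab.2 <= 1 &
          (test_div f ab <= f_div lambda P p q f)%E]]].
Proof.
have [_ p_ge0 _] := hp; have [_ q_ge0 _] := hq.
split; last 2 first.
- exact: test_div_sublevel_convex.
- exact: np_region_sub.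
move=> E alpha beta mE QE PE bdE; split.
- by have [_ _] := np_region_sub hp hq hf bdE.1.
- move=> t0 t0_gt0 fpl Et0.
  have [b [a Fub]] := piecewise_linear_bound t0_gt0 fpl.
  have ilin := integrable_lin (density_integrable hq) (density_integrable hp).
  have [fI0 fI1] := piecewise_linear_affine t0_gt0 fpl.
  have Doo : (f_div lambda P p q f < +oo)%E.
    have [a' [b' fab]] := generator_affine_minorant hf.
    have iF : lambda.-integrable setT (fun x => weighted f (q x) (p x)).
      apply: (integrable_between (ilin b' a') (ilin b a)) => [|x].
        by apply: measurable_weighted => //; [case: hq|case: hp].
      by rewrite weighted_ge_affine// Fub.
    by rewrite (f_divE hp hq hf) ltey_eq integrable_fin_num.
  apply: (equality_condition_eq hp hq hf (f_div_integrable hp hq hf Doo) mE QE PE).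
  have EP x : 0 < q x -> (E x <-> t0 < p x / q x).
    move=> qx; split=> [Ex|t0r].
      by have : (E `&` [set x | 0 < q x]) x by []; rewrite Et0 => -[].
    by have : [set x | 0 < q x /\ t0 < p x / q x] x by []; rewrite -Et0 => -[].
  exists t0%:E, `[0%E, t0%:E], `[t0%:E, +oo%E]; split => //.
  + apply: aeW => x qx; rewrite lte_fin lee_fin; split => [/(EP _ qx)//|].
    by move=> /(EP _ qx) /ltW.
  + by split.
  apply: filterS (np_singular hp hq mE QE PE bdE) => x sing pq.
  rewrite /likelihood_ratio; have [q0|q0] := eqVneq (q x) 0.
    split => [nEx|_]; last by rewrite in_itv/= !leey.
    by move: pq; rewrite q0 addr0 sing// ltxx.
  have qx : 0 < q x by rewrite lt_neqAle eq_sym q0 q_ge0.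
  rewrite !in_itv/= leey andbT !lee_fin divr_ge0//=; split => [nEx|/(EP _ qx)/ltW//].
  by rewrite leNgt; apply/negP => /(EP _ qx).
- move=> Doo; have iF := f_div_integrable hp hq hf Doo; split.
  + exact: (eq_equality_condition hp hq hf iF mE QE PE bdE).
  + exact: (equality_condition_eq hp hq hf iF mE QE PE).
Qed.
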